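(* Let $p$ be an odd prime, let $S$ be a finite $p$-group of sectional rank $3$ and let $\mathcal{F}$ be a saturated fusion system on $S$. Then every $\mathcal{F}$-essential subgroup $E$ of $S$ of rank $2$ that is not $\mathcal{F}$-characteristic in $S$ is an $\mathcal{F}$-pearl.
   Context: The rank of a finite group is the minimal size of a generating set. A $p$-group $S$ has sectional rank $k$ if every subgroup of $S$ has rank at most $k$ and $k$ is minimal with this property. For $P\le S$, $\mathrm{Aut}_{\mathcal{F}}(P)=\mathrm{Hom}_{\mathcal{F}}(P,P)$, $\mathrm{Out}_{\mathcal{F}}(P)=\mathrm{Aut}_{\mathcal{F}}(P)/\mathrm{Inn}(P)$, and $P^{\mathcal{F}}$ is the set of images $P\alpha$ with $\alpha\in\mathrm{Hom}_{\mathcal{F}}(P,S)$. A subgroup $E\le S$ is $\mathcal{F}$-essential if: $C_S(P)\le P$ for every $P\in E^{\mathcal{F}}$; $|N_S(E)|\ge|N_S(P)|$ for every $P\in E^{\mathcal{F}}$; and $\mathrm{Out}_{\mathcal{F}}(E)$ contains a strongly $p$-embedded subgroup. For $Q\le P\le S$, $Q$ is $\mathcal{F}$-characteristic in $P$ if $Q$ is normalized by every element of $\mathrm{Aut}_{\mathcal{F}}(P)$. An $\mathcal{F}$-pearl is an $\mathcal{F}$-essential subgroup that is either elementary abelian of order $p^2$ or non-abelian of order $p^3$. *)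

(* Defs.v *)
From mathcomp Require Import all_boot all_fingroup all_solvable.
Set Implicit Arguments. Unset Strict Implicit. Unset Printing Implicit Defensive.
Local Open Scope group_scope.

(* rank of a finite group = minimal size of a generating set: this is
   MathComp's gen_rank (solvable/abelian.v), NOT 'r(G) (the p-rank). *)

Definition sectional_rank (gT : finGroupType) (S : {set gT}) (k : nat) : Prop :=
  (forall H : {group gT}, H \subset S -> gen_rank H <= k) /\
  (forall k', (forall H : {group gT}, H \subset S -> gen_rank H <= k') -> k <= k').

Definition strongly_p_embedded (aT : finGroupType) (p : nat) (G H : {set aT}) :=
  [/\ H \proper G, p %| #|H| &
      forall g, g \in G :\: H -> ~~ (p %| #|H :&: H :^ g|)].

Section Fusion.
Variables (gT : finGroupType) (S : {group gT}).
(* A fusion system is represented by the predicate F : F P f holds iff f is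
   (the restriction to P of) a morphism in Hom_F(P, S). *)
Variable F : {set gT} -> (gT -> gT) -> bool.

Definition conj_map (g : gT) : gT -> gT := fun x => x ^ g.

Definition is_fusion_system : Prop :=
  [/\ (forall P f, F P f ->
         [/\ group_set P, P \subset S, morphic P f,
             {in P &, injective f} & f @: P \subset S]),
      (forall P f g, F P f -> {in P, f =1 g} -> F P g),
      (forall P g, group_set P -> P \subset S -> g \in S -> F P (conj_map g)),
      (forall P R f g, F P f -> F R g -> f @: P \subset R -> F P (g \o f)) &
      (forall P f, F P f -> exists2 g, F (f @: P) g & {in P, cancel f g})].

Definition Fconj (P Q : {set gT}) : Prop := exists2 f, F P f & Q = f @: P.

Definition fully_normalized (P : {set gT}) : Prop :=
  forall Q, Fconj P Q -> #|'N_S(Q)| <= #|'N_S(P)|.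

Definition fully_centralized (P : {set gT}) : Prop :=
  forall Q, Fconj P Q -> #|'C_S(Q)| <= #|'C_S(P)|.

Definition AutF (P : {set gT}) : {set {perm gT}} :=
  [set a in Aut P | F P (fun x => a x)].

Definition AutS (P : {set gT}) : {set {perm gT}} :=
  [set a in Aut P | [exists g in 'N_S(P), [forall x in P, a x == x ^ g]]].

Definition Inn (P : {set gT}) : {set {perm gT}} :=
  [set a in Aut P | [exists g in P, [forall x in P, a x == x ^ g]]].

Definition OutF (P : {set gT}) := AutF P / Inn P.

(* N_phi = { g in N_S(P) | phi^-1 c_g phi in Aut_S(P phi) } *)
Definition Nphi (P : {set gT}) (f : gT -> gT) : {set gT} :=
  [set g in 'N_S(P) |
     [exists h in 'N_S(f @: P), [forall x in P, f (x ^ g) == f x ^ h]]].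

(* saturation (Broto-Levi-Oliver / Aschbacher-Kessar-Oliver Def. I.2.2) *)
Definition saturated (p : nat) : Prop :=
  [/\ is_fusion_system,
      (forall P : {group gT}, P \subset S -> fully_normalized P ->
         fully_centralized P /\ p.-Sylow(AutF P) (AutS P)) &
      (forall (P : {group gT}) f, F P f -> fully_centralized (f @: P) ->
         exists2 g, F (Nphi P f) g & {in P, g =1 f})].

Definition essential (p : nat) (E : {group gT}) : Prop :=
  [/\ E \subset S,
      (forall P, Fconj E P -> 'C_S(P) \subset P),
      fully_normalized E &
      exists H : {group coset_of (Inn E)},
        strongly_p_embedded p (OutF E) H].

Definition F_characteristic (Q P : {set gT}) : Prop :=
  forall a, a \in AutF P -> a @: Q = Q.

Definition pearl (p : nat) (E : {group gT}) : Prop :=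
  essential p E /\
  ((p.-abelem E && (#|E| == (p ^ 2)%N)) || (~~ abelian E && (#|E| == (p ^ 3)%N))).

End Fusion.

(* Main.v *)
Require Import Defs.
From mathcomp Require Import all_boot all_fingroup all_solvable.
From mathcomp Require Import zify.
Set Implicit Arguments. Unset Strict Implicit. Unset Printing Implicit Defensive.
Local Open Scope group_scope.

(* Let G = Aut_F(E) and N = N_S(E). Strong embedding says that the normal
   p-subgroups of G are inner; hence G is irreducible on E/Phi(E), which has
   order p^2, and N induces on it a group of transvections of order p. As E is
   not F-characteristic in S, some automorphism b of N moves E: conjugation by
   an element of N_S(N) if N < S, and an element of Aut_F(S) if N = S.
   - Phi(E) is b-invariant. Otherwise divide by the largest subgroup invariant
     under G and b, put Z = Omega_1(Z(N)), V = <Z^G> and compare V with V^b: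
     they generate an elementary abelian subgroup of Phi(N), and since its rank
     is at most 3, both possible positions of V^b relative to Phi(E) contradict
     the choice of the quotient.
   - N centralizes T/Phi(T) for T = Phi(E). Otherwise N/T, of order p^3, acts
     faithfully on T/Phi(T), of rank at most 3; b identifies the actions of E
     and E^b, which bounds the order of N/T by p^2.
   - The elements of G trivial on T/Phi(T) form a normal subgroup containing
     transvections with two different axes, hence an element acting as -1 on
     E/T. Its p'-part t centralizes T by coprime action, so [E, t] centralizes
     T; as [E, t] T = E this gives T <= Z(E), and then T = E' has order at
     most p. *)

(** * Automorphisms acting on elements and subgroups *)

Lemma Aut_char (gT : finGroupType) (G H : {group gT}) a x :
  a \in Aut G -> H \char G -> x \in H -> a x \in H.
Proof.
move=> AutGa /andP[_ /forall_inP/(_ a AutGa)/subsetP sHa] Hx.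
by apply: sHa; apply: imset_f.
Qed.

Lemma AutM (gT : finGroupType) (G : {group gT}) a :
  a \in Aut G -> {in G &, {morph a : x y / x * y}}.
Proof. by move/Aut_morphic/morphicP. Qed.

(** * Invariant subgroups and their quotients *)

Section Invariance.

Variable gT : finGroupType.
Implicit Types (G H K M : {group gT}) (A : {set {perm gT}}).

(** Inclusion suffices, since permutations of a finite type preserve cardinality. [A] is a mere set,
    so that [[set b]] is covered too. *)
Definition invar A (X : {set gT}) := [forall a in A, a @: X \subset X].

Lemma invarP {A} {X : {set gT}} :
  reflect (forall a, a \in A -> forall x, x \in X -> a x \in X) (invar A X).
Proof.
apply: (iffP forall_inP) => invX a Aa; last first.
  by apply/subsetP=> _ /imsetP[x Xx ->]; apply: invX.
by move=> x Xx; apply: (subsetP (invX a Aa)); apply: imset_f.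
Qed.

Lemma invar_im {A} {X : {set gT}} a : invar A X -> a \in A -> a @: X = X.
Proof.
move=> /forall_inP invX Aa; apply/eqP.
by rewrite eqEcard invX //= card_imset //; apply: perm_inj.
Qed.

Lemma invarI A (X Y : {set gT}) : invar A X -> invar A Y -> invar A (X :&: Y).
Proof.
move=> /invarP iX /invarP iY; apply/invarP=> a Aa x /setIP[Xx Yx].
by rewrite inE iX ?iY.
Qed.

Lemma char_invar {A G H} : A \subset Aut G -> H \char G -> invar A H.
Proof.
move=> /subsetP sAG chH; apply/invarP=> a /sAG AutGa x.
exact: Aut_char AutGa chH.
Qed.

Lemma Aut_subcent {A G} {X : {set gT}} :
  A \subset Aut G -> X \subset G -> invar A X -> invar A 'C_G(X).
Proof.
move=> /subsetP sAG /subsetP sXG invX; apply/invarP=> a Aa x /setIP[Gx cXx].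
have AutGa := sAG a Aa; rewrite inE Aut_closed //=; apply/centP=> y.
rewrite -{1}(invar_im invX Aa) => /imsetP[{}y Xy ->].
by have Gy := sXG y Xy; rewrite /commute -!(AutM AutGa) // (centP cXx).
Qed.

Lemma Aut_quotient {G K} a :
    a \in Aut G -> K <| G -> invar [set a] K ->
  exists2 b, b \in Aut (G / K) & {in G, forall x, b (coset K x) = coset K (a x)}.
Proof.
move=> AutGa nsKG invK; have [sKG nKG] := andP nsKG.
have aG x : x \in G -> a x \in G by apply: Aut_closed.
have nK x : x \in G -> x \in 'N(K) by apply: (subsetP nKG).
have aK x : x \in G -> (a x \in K) = (x \in K).
  move=> Gx; rewrite -{1}(invar_im invK (set11 a)) mem_imset //.
  exact: perm_inj.
pose f (xb : coset_of K) := coset K (a (repr xb)).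
have fE x : x \in G -> f (coset K x) = coset K (a x).
  move=> Gx; rewrite /f; have: repr (coset K x) \in coset K x by apply: mem_repr_coset.
  rewrite (val_coset (nK x Gx)) => /rcosetP[k Kk ->].
  have Gk: k \in G by rewrite (subsetP sKG).
  by rewrite (AutM AutGa) // coset_kerl // aK.
have fG : f @: (G / K) \subset G / K.
  apply/subsetP=> _ /imsetP[_ /morphimP[x _ Gx ->] ->].
  by rewrite fE // mem_quotient ?aG.
have fI : {in G / K &, injective f}.
  move=> _ _ /morphimP[x nx Gx ->] /morphimP[y ny Gy ->]; rewrite !fE //.
  move/rcoset_kercosetP => /(_ (nK _ (aG _ Gx)) (nK _ (aG _ Gy))) /rcosetP[k Kk axk].
  apply/rcoset_kercosetP=> //; rewrite mem_rcoset -aK ?groupM ?groupV //.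
  by rewrite (AutM AutGa) ?groupV // -(autmE AutGa) morphV //= autmE axk mulgK.
have bE x : x \in G -> perm_in fI fG (coset K x) = coset K (a x).
  by move=> Gx; rewrite perm_inE ?fE // mem_quotient.
exists (perm_in fI fG) => //; rewrite inE perm_in_on.
apply/morphicP=> _ _ /morphimP[x nx Gx ->] /morphimP[y ny Gy ->].
by rewrite -morphM // !bE ?groupM // (AutM AutGa) // morphM ?nK ?aG.
Qed.

Lemma invar_sub {A B : {set {perm gT}}} {X : {set gT}} :
  B \subset A -> invar A X -> invar B X.
Proof. by move=> /subsetP sBA /invarP iX; apply/invarP=> a /sBA; apply: iX. Qed.

Lemma invar1 {A} {X : {set gT}} a : a \in A -> invar A X -> invar [set a] X.
Proof. by rewrite -sub1set => /invar_sub; apply. Qed.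

Lemma char_cosetpre_invar {A G K} {L : {group coset_of K}} :
    A \subset Aut G -> K <| G -> invar A K -> L \char G / K ->
  invar A (coset K @*^-1 L).
Proof.
move=> /subsetP sAG nsKG invK chL; apply/invarP=> a Aa x /morphpreP[nx Lx].
have [b Autb bE] := Aut_quotient (sAG a Aa) nsKG (invar1 Aa invK).
have Gx : x \in G.
  rewrite -(quotientGK nsKG); apply/morphpreP; split=> //.
  exact: subsetP (char_sub chL) _ Lx.
have Gax := Aut_closed (sAG a Aa) Gx.
apply/morphpreP; split; first exact: subsetP (normal_norm nsKG) _ Gax.
rewrite /= -bE //; exact: Aut_char Autb chL Lx.
Qed.

Lemma quotient_cent_invar {A G K M} :
    A \subset Aut G -> K <| G -> M \subset G -> invar A K -> invar A M ->
  invar A (G :&: coset K @*^-1 'C(M / K)).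
Proof.
move=> /subsetP sAG nsKG sMG invK invM; have [sKG nKG] := andP nsKG.
apply/invarP=> a Aa x /setIP[Gx /morphpreP[nx cMx]].
have [b Autb bE] := Aut_quotient (sAG a Aa) nsKG (invar1 Aa invK).
have Gax := Aut_closed (sAG a Aa) Gx.
rewrite inE Gax; apply/morphpreP; split; first exact: subsetP nKG _ Gax.
rewrite /= -bE //; apply/centP=> _ /morphimP[y _ My ->].
move: My; rewrite -{1}(invar_im invM Aa) => /imsetP[{}y My ->].
have Gy := subsetP sMG y My.
rewrite /commute /= -bE // -!(AutM Autb) ?mem_quotient //.
by rewrite (centP cMx) // mem_quotient.
Qed.

End Invariance.

(** * Commutators and indices of centralizers *)

Lemma comm_mulr_sub (gT : finGroupType) (M X Y : {set gT}) (W : {group gT}) :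
    [~: M, X] \subset W -> [~: M, Y] \subset W -> Y \subset 'N(W) ->
  [~: M, X * Y] \subset W.
Proof.
move=> /subsetP sMX /subsetP sMY /subsetP nWY.
rewrite gen_subG; apply/subsetP=> _ /imset2P[m _ Mm /mulsgP[x y Xx Yy ->] ->].
by rewrite commgMJ groupM ?memJ_norm ?nWY //; [apply: sMY | apply: sMX];
  rewrite mem_commg.
Qed.

Section Counting.

Variables (gT : finGroupType) (p : nat).
Implicit Types M Q Z : {group gT}.

(** The index is the size of the class of [m] under [Q], and this class lies in the translate
    [m W]. *)
Lemma index_cent1_le {Q} m (W : {set gT}) :
  (forall q, q \in Q -> [~ m, q] \in W) -> #|Q : 'C_Q[m]| <= #|W|.
Proof.
move=> mQ; rewrite index_cent1 -(card_imset (mem W) (mulgI m)) subset_leq_card //.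
apply/subsetP=> _ /imsetP[q Qq ->]; apply/imsetP; exists [~ m, q]; first exact: mQ.
by rewrite commgEl mulKVg.
Qed.

Lemma cent1_cycle_cent {Q M Z} m :
  Q \subset 'C(Z) -> M \subset <[m]> <*> Z -> 'C_Q[m] \subset 'C_Q(M).
Proof.
move=> cQZ sMmZ; rewrite subsetI subsetIl centsC (subset_trans sMmZ) //.
rewrite join_subG cycle_subG -cent_set1 -sub1set centsC subsetIr /=.
by rewrite centsC (subset_trans _ cQZ) // subsetIl.
Qed.

Lemma prime_index_join {M Z} m :
  Z \subset M -> prime #|M : Z| -> m \in M -> m \notin Z -> <[m]> <*> Z = M.
Proof.
move=> sZM pr_MZ Mm nZm; apply/eqP; rewrite eqEsubset join_subG cycle_subG Mm sZM /=.
have sZJ: Z \subset <[m]> <*> Z by apply: joing_subr.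
have sJM: <[m]> <*> Z \subset M by rewrite join_subG cycle_subG Mm.
have LI := Lagrange_index sJM sZJ.
have dvJ : #|<[m]> <*> Z : Z| %| #|M : Z| by rewrite -LI dvdn_mull.
have /primeP[_ /(_ _ dvJ)/orP[] /eqP J1] := pr_MZ.
  case/negP: nZm; have /subsetP->// : <[m]> <*> Z \subset Z.
    by rewrite -indexg_eq1 J1.
  by rewrite mem_gen // inE cycle_id.
move/eqP: LI; rewrite J1 -[X in _ == X]mul1n eqn_pmul2r ?prime_gt0 //.
by rewrite indexg_eq1.
Qed.

(** [M / Z] is normal of prime order in the nilpotent group [Q / Z], so it meets the center
    nontrivially and is therefore central. *)
Lemma prime_index_comm Q M Z :
    prime p -> p.-group Q -> M <| Q -> Z <| Q -> Z \subset M -> #|M : Z| = p ->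
  [~: M, Q] \subset Z.
Proof.
move=> p_pr pQ nsMQ nsZQ sZM iMZ; have [[sMQ _] [_ nZQ]] := (andP nsMQ, andP nsZQ).
have oMZ : #|M / Z| = p by rewrite card_quotient // (subset_trans sMQ).
rewrite -quotient_cents2 ?(subset_trans sMQ) //.
have ntMZ : M / Z != 1 by rewrite -cardG_gt1 oMZ prime_gt1.
have nilQ : nilpotent (Q / Z) by rewrite quotient_nil // (pgroup_nil pQ).
have/prime_meetG := meet_center_nil nilQ (quotient_normal Z nsMQ) ntMZ.
by rewrite oMZ => /(_ p_pr)/subset_trans-> //; rewrite subsetIr.
Qed.

(** Let [Z] be the part of [M] central in [Q]. Unless [M = Z] it has index p in [M], and the class
    of any [m] outside [Z] lies in [m Z], of size at most p. *)
Lemma index_cent_p2 Q M :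
    prime p -> p.-group Q -> M <| Q -> #|M| <= p ^ 2 ->
  #|Q : 'C_Q(M)| <= p.
Proof.
move=> p_pr pQ nsMQ leM; have [sMQ _] := andP nsMQ.
have pM := pgroupS sMQ pQ.
have [-> | ntM] := eqVneq (M : {set gT}) 1.
  by rewrite cent1T setIT indexgg prime_gt0.
pose Z := (M :&: 'Z(Q))%G.
have ntZ : Z :!=: 1 by apply: meet_center_nil ntM; rewrite ?(pgroup_nil pQ).
have sZM : Z \subset M by apply: subsetIl.
have cQZ : Q \subset 'C(Z) by rewrite centsC subIset // orbC subsetIr.
have [sMZ | /subsetPn[m Mm nZm]] := boolP (M \subset Z).
  by rewrite (setIidPl _) ?indexgg ?prime_gt0 // centsC (subset_trans sMZ) // centsC.
have iMZ : #|M : Z| = p.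
  have [_ _ [k oZ]] := pgroup_pdiv (pgroupS sZM pM) ntZ.
  have [l iMZ] := p_natP (pnat_dvd (dvdn_indexg M Z) pM).
  move: leM; rewrite -(Lagrange sZM) iMZ oZ -expnD leq_exp2l ?prime_gt1 // => lekl.
  case: l => [|[|l]] in iMZ lekl *; rewrite ?iMZ ?expn1 //.
    by case/negP: nZm; rewrite (subsetP _ m Mm) // -indexg_eq1 iMZ.
  by rewrite !addnS ltnS addSn ltnS in lekl.
have pZ : #|Z| <= p.
  have:= leM; rewrite -(Lagrange sZM) iMZ expnS expn1 leq_pmul2r //.
  exact: prime_gt0.
apply: leq_trans _ pZ; have nsZQ : Z <| Q by rewrite normalI ?gFnormal.
have jM := prime_index_join sZM _ Mm nZm.
have cmM : 'C_Q[m] \subset 'C_Q(M) by rewrite (cent1_cycle_cent cQZ) // jM ?iMZ.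
apply: leq_trans (dvdn_leq _ (indexgS Q cmM)) _; rewrite ?indexg_gt0 //.
apply: index_cent1_le => q Qq.
by rewrite (subsetP (prime_index_comm _ pQ nsMQ nsZQ _ iMZ)) ?mem_commg.
Qed.

End Counting.

Lemma sub_Ohm1_center (p : nat) (gT : finGroupType) (G X : {group gT}) :
  p.-abelem X -> X \subset 'Z(G) -> X \subset 'Ohm_1('Z(G)).
Proof. by move=> abX sXZ; rewrite -{1}(Ohm1_id abX) OhmS. Qed.

Lemma Ohm1_center_abelem (p : nat) (gT : finGroupType) (G : {group gT}) :
  p.-group G -> p.-abelem 'Ohm_1('Z(G)).
Proof.
by move=> pG; rewrite Ohm1_abelem ?center_abelian // (pgroupS (center_sub G)).
Qed.

(** * Automorphisms of a p-group and of a maximal subgroup *)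

(* In the application N = N_S(E), A = Aut_F(E) and b is an automorphism of N
   that moves E; E and its image [twin] play the role of the two parabolics of
   an amalgam of type L_3(p). *)
Record pushing (gT : finGroupType) (p : nat) (N E : {group gT})
    (A : {set {perm gT}}) (b : {perm gT}) : Prop := Pushing {
  push_p : prime p;
  push_pgroup : p.-group N;
  push_normal : E <| N;
  push_index : #|N : E| = p;
  push_Frattini : #|E : 'Phi(E)| = (p ^ 2)%N;
  push_Aut : A \subset Aut E;
  push_conj : {in N, forall x, exists2 a, a \in A & {in E, a =1 conjg^~ x}};
  push_irr : forall X : {group gT},
    X \subset E -> invar A X -> X :=: E \/ X \subset 'Phi(E);
  push_noncentral : ~~ ([~: E, N] \subset 'Phi(E));
  push_aut : b \in Aut N;
  push_moves : b @: E != E;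
  push_grank : forall X : {group gT}, X \subset N -> 'm(X) <= 3
}.

Section Pushing.

Variables (gT : finGroupType) (p : nat) (N E : {group gT}).
Variables (A : {set {perm gT}}) (b : {perm gT}).
Hypothesis am : pushing p N E A b.
Implicit Type X : {group gT}.

Let p_pr := push_p am.
Let pN := push_pgroup am.
Let sEN := normal_sub (push_normal am).
Let pE := pgroupS sEN pN.

Lemma push_invar_normal X : X \subset E -> invar A X -> X <| N.
Proof.
move=> sXE /invarP iX; rewrite /normal (subset_trans sXE sEN).
apply/normsP=> x Nx; apply/eqP; rewrite eqEcard cardJg leqnn andbT.
apply/subsetP=> _ /imsetP[y Xy ->]; have [a Aa ax] := push_conj am Nx.
by rewrite -ax ?iX // (subsetP sXE).
Qed.

Definition twin : {group gT} := (autm (push_aut am) @* E)%G.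

Lemma twinE : twin :=: b @: E.
Proof. by rewrite /= morphimEsub. Qed.

Lemma twin_normal : twin <| N.
Proof.
have := morphim_normal (autm_morphism (push_aut am)) (push_normal am).
by rewrite im_autm.
Qed.

Lemma card_twin : #|twin| = #|E|.
Proof. by rewrite twinE card_imset //; apply: perm_inj. Qed.

Lemma push_maximal X : X \subset N -> #|X| = #|E| -> maximal X N.
Proof.
move=> sXN oX; apply: (p_index_maximal sXN).
by rewrite -(divgS sXN) oX divgS // (push_index am).
Qed.

Lemma twin_not_sub : ~~ (twin \subset E).
Proof.
apply/negP=> sE2E; case/negP: (push_moves am).
by rewrite -twinE eqEcard sE2E card_twin /=.
Qed.

Lemma push_join : E * twin = N.
Proof.
apply: mulg_normal_maximal (push_normal am) _ (normal_sub twin_normal) twin_not_sub.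
exact: push_maximal sEN (erefl _).
Qed.

Lemma Phi_sub_twinI : 'Phi(N) \subset E :&: twin.
Proof.
rewrite subsetI; apply/andP; split; apply: Phi_sub_max.
  exact: push_maximal sEN (erefl _).
exact: push_maximal (normal_sub twin_normal) card_twin.
Qed.

(** Otherwise maximality of [E] gives [N = E Z(N)], so that [[E, N]] lies in [Phi(E)], against
    [push_noncentral]. *)
Lemma center_sub_push : 'Z(N) \subset E.
Proof.
apply: contraR (push_noncentral am) => nZE.
have EZ : E * 'Z(N) = N.
  apply: mulg_normal_maximal (push_maximal sEN (erefl _)) _ _ => //.
    exact: push_normal am.
  exact: subsetIl.
rewrite -EZ comm_mulr_sub //.
- by rewrite -derg1 /= (Phi_joing pE) joing_subl.
- by rewrite (commG1P _) ?sub1G // centsC (subset_trans (subsetIr _ _)) ?centS.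
by rewrite (subset_trans (subsetIl _ _)) // gFnorm_trans ?normal_norm ?(push_normal am).
Qed.

Lemma card_abelem_push X : X \subset N -> p.-abelem X -> #|X| <= p ^ 3.
Proof.
move=> sXN abX; have:= push_grank am sXN.
rewrite grank_abelian ?(abelem_abelian abX) // (rank_abelem abX) => lX.
by rewrite (card_pgroup (abelem_pgroup abX)) leq_exp2l ?prime_gt1.
Qed.

Let f := autm_morphism (push_aut am).

Lemma twin_char X : X \char N -> f @* X = X.
Proof. by case/charP=> _; apply; rewrite ?injm_autm ?im_autm. Qed.

Lemma char_invar_twin X : X \char N -> invar [set b] X.
Proof. by apply: char_invar; rewrite sub1set (push_aut am). Qed.

(** The pushing-up argument. As no nontrivial subgroup of [E] is invariant under [A] and [b], the
    [b]-invariant group [Z = Omega_1(Z(N))] is smaller than its closure [V] under [A]. If [V] lies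
    in [Phi(E)], the rank bound forces [|Z| = p] and [|V| = p^2], and each position of the image of
    [V] under [b] leads to a contradiction. *)
Lemma Phi_core_free :
    (forall X, X \subset E -> invar A X -> invar [set b] X -> X :=: 1) ->
  'Phi(E) = 1.
Proof.
move=> cf; pose Z := 'Ohm_1('Z(N))%G.
have chZ : Z \char N := char_trans (Ohm_char 1 _) (center_char _).
have sZE : Z \subset E := subset_trans (Ohm_sub 1 _) center_sub_push.
have abZ : p.-abelem Z := Ohm1_center_abelem pN.
have iE : invar A E := char_invar (push_Aut am) (char_refl E).
(* Minimality of [V], used against ['Ohm_1('Z(E))], makes it elementary abelian and central in
   [E]. *)
have [V /mingroupP[/andP[sZV iV] minV] sVE] :
    {V : {group gT} | [min V | (Z \subset V) && invar A V] & V \subset E}.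
  by apply: mingroup_exists; rewrite sZE.
have iOm : invar A 'Ohm_1('Z(E)).
  by rewrite (char_invar (push_Aut am)) // (char_trans (Ohm_char 1 _)) ?center_char.
have sVOm : V \subset 'Ohm_1('Z(E)).
  apply/setIidPl; apply: minV (subsetIl _ _); rewrite invarI // subsetI sZV andbT /=.
  by rewrite OhmS // subsetI center_sub_push (subset_trans (subsetIr _ _)) ?centS.
have sVZ : V \subset 'Z(E) := subset_trans sVOm (Ohm_sub 1 _).
have cVE : V \subset 'C(E) := subset_trans sVZ (subsetIr _ _).
have abV : p.-abelem V := abelemS sVOm (Ohm1_center_abelem pE).
have ntE : E :!=: 1.
  apply/eqP=> E1; have:= dvdn_indexg E 'Phi(E).
  by rewrite (push_Frattini am) E1 cards1 dvdn1 -(expn0 p) eqn_exp2l ?prime_gt1.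
have ntZ : Z :!=: 1.
  rewrite /= Ohm1_eq1; apply: contraNneq ntE => /(trivg_center_pgroup pN) N1.
  by rewrite -subG1 -N1.
have ntV : V :!=: 1 by apply: contraNneq ntZ => V1; rewrite -subG1 -V1.
(* [Z] is characteristic in [N], hence [b]-invariant; if it were [V], it would be invariant under
   [A] as well, hence trivial. *)
have neqZV : ~~ (V \subset Z).
  apply: contra ntZ => sVZN; apply/eqP; apply: cf (char_invar_twin chZ) => //.
  suff <- : V :=: Z by []. by apply/eqP; rewrite eqEsubset sVZN.
case: (push_irr am sVE iV) => [VE | sVPhi].
  by apply/eqP; rewrite (trivg_Phi pE) -VE.
have sPhiPhi : 'Phi(E) \subset 'Phi(N) := PhiS pN sEN.
have [sPhiE sPhiT] := subsetIP Phi_sub_twinI.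
have pPhi : p.-group 'Phi(N) := pgroupS (Phi_sub N) pN.
pose Y := 'Ohm_1('Z('Phi(N)))%G.
have chY : Y \char N.
  by rewrite (char_trans (Ohm_char 1 _)) // (char_trans (center_char _)) ?Phi_char.
have abY : p.-abelem Y := Ohm1_center_abelem pPhi.
have sYPhi : Y \subset 'Phi(N) := subset_trans (Ohm_sub 1 _) (center_sub _).
have sVY : V \subset Y.
  rewrite (sub_Ohm1_center abV) // subsetI (subset_trans sVPhi) //=.
  by rewrite (subset_trans cVE) ?centS.
have sVN := subset_trans sVE sEN.
pose V2 := (f @* V)%G.
have oV2 : #|V2| = #|V| by rewrite card_injm ?injm_autm.
have sV2Y : V2 \subset Y by rewrite -(twin_char chY) morphimS.
have cV2T : V2 \subset 'C(twin) by apply: morphim_cents.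
have nsV : V <| N := push_invar_normal sVE iV.
have nsV2 : V2 <| N by rewrite -(im_autm (push_aut am)) (morphim_normal f).
have abV2 : p.-abelem V2 := abelemS sV2Y abY.
have cZ X : p.-abelem X -> X \subset N -> X \subset 'C(E) -> X \subset 'C(twin) -> X \subset Z.
  move=> abX sXN cXE cXT; rewrite (sub_Ohm1_center abX) // subsetI sXN.
  by rewrite -push_join centM subsetI cXE.
have sZV2 : Z \subset V2 by rewrite -(twin_char chZ) morphimS.
(* What lies in both [V] and [V2] centralizes [E] and its twin, hence their product [N]. *)
have IV : V :&: V2 = Z.
  apply/eqP; rewrite eqEsubset subsetI sZV sZV2 !andbT.
  apply: cZ; rewrite ?(abelemS (subsetIl _ _) abV) ?subIset ?sVN ?cVE //.
  by rewrite cV2T orbT.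
have sVV2Y : V * V2 \subset Y by rewrite mul_subG.
have leY := card_abelem_push (char_sub chY) abY.
have [k oZ] := p_natP (abelem_pgroup abZ); have [l oV] := p_natP (abelem_pgroup abV).
have oVV2 : (#|V * V2|%g * p ^ k = p ^ (l + l))%N.
  by rewrite -oZ -IV expnD -oV -{2}oV2 mul_cardG.
have p1 := prime_gt1 p_pr.
have k0 : 0 < k.
  by rewrite lt0n; apply: contraNneq ntZ => k0; rewrite trivg_card1 oZ k0.
have ltkl : k < l.
  rewrite -(ltn_exp2l _ _ p1) -oZ -oV proper_card // properE sZV.
  exact: neqZV.
have leVV2 : l + l <= 3 + k.
  rewrite -(leq_exp2l _ _ p1) -oVV2 expnD leq_mul //.
  exact: leq_trans (subset_leq_card sVV2Y) leY.
(* Since [2 l <= 3 + k] and [0 < k < l]. Hence [V V2] has order p^3 and fills [Y]. *)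
have [k1 l2] : k = 1%N /\ l = 2.
  by clear -k0 ltkl leVV2; lia.
rewrite k1 expn1 in oZ; rewrite l2 in oV; rewrite oV in oV2.
have card_VV2 : #|V * V2| = (p ^ 3)%N.
  apply/eqP; rewrite -(eqn_pmul2r (prime_gt0 p_pr)) -expnSr.
  by rewrite k1 l2 expn1 in oVV2; rewrite oVV2.
have eYVV2 : V * V2 = Y by apply/eqP; rewrite eqEcard sVV2Y card_VV2.
have iV2Z : #|V2 : Z| = p by rewrite -divgS // oV2 oZ expnS expn1 mulnK ?prime_gt0.
have sV2NZ : [~: V2, N] \subset Z.
  exact: prime_index_comm p_pr pN nsV2 (char_normal chZ) sZV2 iV2Z.
have sV2E : V2 \subset E := subset_trans sV2Y (subset_trans sYPhi sPhiE).
have sV2EZ : [~: V2, E] \subset Z := subset_trans (commgS _ sEN) sV2NZ.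
(* V2 <= Phi(E): the b-invariant subgroup Y = V V2 is also A-invariant. *)
have [sV2P | nsV2P] := boolP (V2 \subset 'Phi(E)).
  pose Y1 := 'Ohm_1('Z('Phi(E)))%G.
  have abY1 : p.-abelem Y1 := Ohm1_center_abelem (pgroupS (Phi_sub E) pE).
  have chY1 : Y1 \char E.
    by rewrite (char_trans (Ohm_char 1 _)) // (char_trans (center_char _)) ?Phi_char.
  have sYY1 : Y \subset Y1.
    rewrite -eYVV2 mul_subG ?(sub_Ohm1_center abV) ?(sub_Ohm1_center abV2) // subsetI ?sVPhi ?sV2P.
      by rewrite /= (subset_trans cVE) ?centS ?Phi_sub.
    by rewrite /= (subset_trans cV2T) ?centS ?(subset_trans sPhiPhi).
  have eYY1 : Y :=: Y1.
    apply/eqP; rewrite eqEcard sYY1 (leq_trans (card_abelem_push _ abY1)) //.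
      exact: subset_trans (char_sub chY1) sEN.
    by rewrite -eYVV2 card_VV2.
  have Y_1: Y :=: 1.
    apply: cf; [exact: subset_trans sYPhi sPhiE | | exact: char_invar_twin].
    by rewrite eYY1; apply: char_invar (push_Aut am) chY1.
  by case/eqP: ntV; apply/trivgP; rewrite -Y_1.
(* V2 is not in Phi(E): then Phi(E) = V, and E is abelian or E' = Z. *)
have nsVE : V <| E := normalS sVE sEN nsV.
have nVE := normal_norm nsVE.
pose L := 'Ohm_1('Z(E / V))%G.
have abL : p.-abelem L := Ohm1_center_abelem (quotient_pgroup V pE).
have chL : L \char E / V by rewrite (char_trans (Ohm_char 1 _)) ?center_char.
have iL := char_cosetpre_invar (push_Aut am) nsVE iV chL.
have sWE : coset V @*^-1 L \subset E.
  by rewrite -(quotientGK nsVE) morphpreS // char_sub.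
have sV2W : V2 \subset coset V @*^-1 L.
  rewrite -sub_quotient_pre ?(subset_trans sV2E) // (sub_Ohm1_center (quotient_abelem V abV2)) //.
  rewrite subsetI quotientS //= quotient_cents2 ?(subset_trans sV2E) //.
  exact: subset_trans sZV.
(* The preimage of [L] contains [V2], which is not in [Phi(E)]; irreducibility makes it all of [E],
   so [E / V] is elementary abelian. *)
have [WE | sWP] := push_irr am (X := (coset V @*^-1 L)%G) sWE iL; last first.
  by case/negP: nsV2P; apply: subset_trans sWP.
have abEV : p.-abelem (E / V) by rewrite -{1}WE cosetpreK.
have ePV : 'Phi(E) = V.
  by apply/eqP; rewrite eqEsubset sVPhi andbT (Phi_min pE).
have sZY := subset_trans sZV sVY.
have nsZE : Z <| E := normalS sZE sEN (char_normal chZ).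
have sYE := subset_trans sYPhi sPhiE.
(* [Y / Z] is central in [E / Z], and its index is p because [|E| = p^4] and [|Y| = p^3]; so [E / Z]
   is abelian. *)
have cEE : E^`(1) \subset Z.
  apply: der1_min (normal_norm nsZE) _; apply: (@cyclic_factor_abelian _ (Y / Z)%G).
    rewrite subsetI quotientS //= quotient_cents2 ?(subset_trans sYE) ?(normal_norm nsZE) //.
    rewrite -eYVV2 commGC; apply: comm_mulr_sub.
    - by rewrite commGC (commG1P cVE) sub1G.
    - by rewrite commGC.
    exact: subset_trans (subset_trans sV2E sEN) (char_norm chZ).
  have nsYE : Y <| E := normalS sYE sEN (char_normal chY).
  rewrite (isog_cyclic (third_isog sZY nsZE nsYE)) prime_cyclic //.
  rewrite card_quotient ?normal_norm // -divgS // -eYVV2 card_VV2.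
  rewrite -(Lagrange (Phi_sub E)) (push_Frattini am) /= ePV oV -expnD.
  by rewrite (expnS p 3) mulnK ?expn_gt0 ?prime_gt0.
have [sVE1 | nsVE1] := boolP (V \subset E^`(1)).
  by case/negP: neqZV; apply: subset_trans cEE.
(* A nontrivial [E'] would be the group [Z] of order p, which would then be invariant under [A] and
   equal to [V] by minimality. *)
have E1_1 : E^`(1) = 1.
  apply: contraNeq nsVE1 => ntE1.
  have eE1 : E^`(1) = Z.
    have pr_Z : prime #|Z| by rewrite oZ.
    apply/eqP; rewrite eqEsubset cEE; apply: contraR ntE1 => nsZE1.
    by rewrite -(setIidPr cEE) (prime_TIg pr_Z).
  have iZ : invar A Z by rewrite -eE1 (char_invar (push_Aut am)) ?der_char.
  by rewrite eE1 (minV Z) // iZ subxx.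
have cEE1 : abelian E by apply/derG1P.
have sV2Z : V2 \subset Z.
  by apply: cZ => //; [apply: normal_sub | apply: subset_trans cEE1].
have /eqP i1 : #|V2 : Z| == 1%N by rewrite indexg_eq1.
by rewrite -iV2Z i1 in p1.
Qed.

End Pushing.

(** * Quotients by subgroups invariant under [A] and [b] *)

Lemma cosetpre_invarP (gT : finGroupType) (G K : {group gT}) (a : {perm gT})
    (c : {perm coset_of K}) (X : {group coset_of K}) :
    K <| G -> a \in Aut G -> {in G, forall x, c (coset K x) = coset K (a x)} ->
    X \subset G / K -> (forall x, x \in X -> c x \in X) ->
  forall x, x \in coset K @*^-1 X -> a x \in coset K @*^-1 X.
Proof.
move=> nsKG AutGa cE sXG cX x /morphpreP[nx Xx].
have Gx : x \in G.
  by rewrite -(quotientGK nsKG); apply/morphpreP; split=> //; apply: subsetP sXG _ Xx.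
apply/morphpreP; split; first by rewrite (subsetP (normal_norm nsKG)) ?Aut_closed.
by rewrite /= -cE ?cX.
Qed.

(** As [K] lies in [Phi(E)], the quotient [E / Phi(E)] and the conditions on it are unchanged, and
    generator ranks do not grow. The last three clauses transport invariant subgroups between the
    two levels. *)
Lemma push_quotient (gT : finGroupType) (p : nat) (N E K : {group gT}) A b :
    pushing p N E A b -> K \subset 'Phi(E) -> invar A K -> invar [set b] K ->
  exists A', exists b', [/\ pushing p (N / K) (E / K) A' b',
    forall X : {group coset_of K}, X \subset E / K -> invar A' X ->
      invar A (coset K @*^-1 X),
    forall X : {group coset_of K}, X \subset N / K -> invar [set b'] X ->
      invar [set b] (coset K @*^-1 X) &
    forall X : {group gT}, X \subset N -> invar [set b] X -> invar [set b'] (X / K)].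
Proof.
move=> am sKPhi iAK ibK.
case: (am) => p_pr pN nsEN iNE iEPhi sAE conjA irrA ncE AutNb moveb rkN.
have sEN := normal_sub nsEN; have pE := pgroupS sEN pN.
have sKE : K \subset E := subset_trans sKPhi (Phi_sub E).
have nsKN : K <| N := push_invar_normal am sKE iAK.
have nsKE : K <| E := normalS sKE sEN nsKN.
have [nKN nKE] := (normal_norm nsKN, normal_norm nsKE).
have [b' Autb' b'E] := Aut_quotient AutNb nsKN ibK.
(* [Aut_quotient] only asserts existence, so [A'] collects every automorphism of [E / K] induced by
   a member of [A]. *)
pose A' := [set c in Aut (E / K) |
  [exists a in A, [forall x in E, c (coset K x) == coset K (a x)]]].
have preA (X : {group coset_of K}) :
    X \subset E / K -> invar A' X -> invar A (coset K @*^-1 X).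
  move=> sXE /invarP iX; apply/invarP=> a Aa x Xx.
  have AutEa := subsetP sAE a Aa.
  have [c Autc cE] := Aut_quotient AutEa nsKE (invar1 Aa iAK).
  apply: (cosetpre_invarP nsKE AutEa cE sXE) Xx => y; apply: iX.
  rewrite inE Autc; apply/exists_inP; exists a => //.
  by apply/forall_inP=> z Ez; rewrite cE.
have subE (X : {group coset_of K}) : X \subset E / K -> coset K @*^-1 X \subset E.
  by move=> sXE; rewrite -(quotientGK nsKE) morphpreS.
have PhiEK : 'Phi(E / K) = 'Phi(E) / K by rewrite (quotient_Phi pE).
exists A', b'; split=> //; last first.
- move=> X sXN ibX; apply/invarP=> _ /set1P-> _ /morphimP[x nx Xx ->].
  by rewrite /= b'E ?(subsetP sXN) // mem_quotient // (invarP ibX) ?set11.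
- move=> X sXN /invarP ibX; apply/invarP=> _ /set1P-> x Xx.
  by apply: (cosetpre_invarP nsKN AutNb b'E sXN) Xx => y; apply: ibX; rewrite set11.
split=> //.
- exact: quotient_pgroup.
- exact: quotient_normal.
- by rewrite index_quotient_eq // subIset // sKE orbT.
- by rewrite PhiEK index_quotient_eq ?Phi_sub // subIset // sKPhi orbT.
- by apply/subsetP=> c /setIdP[].
- move=> _ /morphimP[x nx Nx ->]; have [a Aa ax] := conjA x Nx.
  have AutEa := subsetP sAE a Aa.
  have [c Autc cE] := Aut_quotient AutEa nsKE (invar1 Aa iAK).
  exists c.
    rewrite inE Autc; apply/exists_inP; exists a => //.
    by apply/forall_inP=> z Ez; rewrite cE.
  move=> _ /morphimP[e ne Ee ->]; rewrite /= cE // ax //= morphJ //.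
- move=> X sXE iX; have [eX | sX] := irrA _ (subE X sXE) (preA X sXE iX).
    by left; rewrite /= -eX /= cosetpreK.
  by right; rewrite PhiEK -(cosetpreK X) quotientS.
- apply: contra ncE; rewrite PhiEK -quotientR // quotientSGK //.
  by rewrite comm_subG.
- apply: contra moveb => /eqP b'EK; rewrite eqEcard card_imset ?leqnn ?andbT; last first.
    exact: perm_inj.
  apply/subsetP=> _ /imsetP[x Ex ->]; have Nx := subsetP sEN x Ex.
  rewrite -(quotientGK nsKE); apply/morphpreP; split.
    by rewrite (subsetP nKN) ?Aut_closed.
  by rewrite /= -b'E // -b'EK imset_f // mem_quotient.
move=> X sXN.
have sWN : coset K @*^-1 X \subset N by rewrite -(quotientGK nsKN) morphpreS.
apply: leq_trans (rkN (coset K @*^-1 X)%G sWN).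
by rewrite -{1}(cosetpreK X) quotient_grank // (subset_trans sWN).
Qed.

Lemma invar_char_trans (gT : finGroupType) (G H K : {group gT}) a :
    a \in Aut G -> H \subset G -> invar [set a] H -> K \char H ->
  invar [set a] K.
Proof.
move=> AutGa sHG iH /charP[sKH chK].
pose g := restrm_morphism sHG (autm_morphism AutGa).
have gE (X : {set gT}) : X \subset H -> g @* X = a @: X.
  by move=> sXH; rewrite morphimEsub.
have gK : g @* K = K.
  apply: chK; first by rewrite injm_restrm ?injm_autm.
  by rewrite gE // (invar_im iH) ?set11.
by apply/invarP=> _ /set1P-> x Kx; rewrite -gK gE // imset_f.
Qed.

(** * Invariance of the Frattini subgroup under [b] *)

Section FrattiniAction.

Variables (gT : finGroupType) (p : nat) (N E : {group gT}).
Variables (A : {set {perm gT}}) (b : {perm gT}).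
Hypothesis am : pushing p N E A b.

(** Divide by the largest subgroup [T] of [Phi(E)] invariant under [A] and [b]. The quotient
    satisfies the hypothesis of [Phi_core_free], so [Phi(E / T)] is trivial and [T = Phi(E)]. *)
Lemma Phi_invar_twin : invar [set b] 'Phi(E).
Proof.
have nbE : ~~ invar [set b] E.
  apply: contra (push_moves am) => /invar_im-> //; exact: set11.
have [T /maxgroupP[/and3P[sTPhi iAT ibT] maxT] _] :
    {T : {group gT} | [max T | [&& T \subset 'Phi(E), invar A T & invar [set b] T]]
       & 1%G \subset T}.
  apply: maxgroup_exists; rewrite sub1G (char_invar (push_Aut am)) ?char1 //.
  by rewrite (char_invar_twin am) ?char1.
have [A' [b' [am' preA preb _]]] := push_quotient am sTPhi iAT ibT.
have pE := pgroupS (normal_sub (push_normal am)) (push_pgroup am).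
have sTE := subset_trans sTPhi (Phi_sub E).
have nsTE : T <| E.
  exact: normalS sTE (normal_sub (push_normal am)) (push_invar_normal am sTE iAT).
have Phi1 : 'Phi(E / T) = 1.
  apply: (Phi_core_free am') => X sXE iAX ibX.
  have iAW := preA X sXE iAX.
  have ibW : invar [set b] (coset T @*^-1 X).
    apply: preb => //; apply: subset_trans sXE _.
    by rewrite quotientS ?normal_sub ?(push_normal am).
  have sWE : coset T @*^-1 X \subset E by rewrite -(quotientGK nsTE) morphpreS.
  have [WE | sWP] := push_irr am (X := (coset T @*^-1 X)%G) sWE iAW.
    by case/negP: nbE; rewrite -WE.
  have := maxT (coset T @*^-1 X)%G; rewrite sWP iAW ibW sub_cosetpre => WT.
  by rewrite -(cosetpreK X) WT // trivg_quotient.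
suff -> : 'Phi(E) = T by [].
apply/eqP; rewrite eqEsubset sTPhi andbT -quotient_sub1 ?gFsub_trans ?normal_norm //.
by rewrite (quotient_Phi pE) ?normal_norm // Phi1.
Qed.

End FrattiniAction.

(** * The action of [N] on the Frattini subgroup *)

Section AbelianFrattini.

Variables (gT : finGroupType) (p : nat) (N E : {group gT}).
Variables (A : {set {perm gT}}) (b : {perm gT}).
Hypothesis am : pushing p N E A b.
Hypothesis abM : p.-abelem 'Phi(E).

(** By irreducibility [C_E(M)] is [E] or lies in [M = Phi(E)]. In the first case [b] carries the
    conclusion from [E] to its twin, and the two generate [N]. In the second [N / M], of order p^3,
    acts faithfully on [M], and comparing the actions of [E] and its twin contradicts this order. *)
Lemma abelem_Phi_cent : 'Phi(E) \subset 'C(N).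
Proof.
case: (am) => p_pr pN nsEN iNE iEM sAE conjA irrA ncE AutNb moveb rkN.
have sEN := normal_sub nsEN; have pE := pgroupS sEN pN.
have p1 := prime_gt1 p_pr; have p0 := prime_gt0 p_pr.
pose M := 'Phi(E)%G; pose f := autm_morphism AutNb; pose E2 := twin am.
have ibM : invar [set b] M := Phi_invar_twin am.
have sME : M \subset E := Phi_sub E; have sMN := subset_trans sME sEN.
have iAM : invar A M := char_invar sAE (Phi_char E).
have nsMN : M <| N := push_invar_normal am sME iAM.
have pM : p.-group M := pgroupS sMN pN.
have fM : f @* M = M.
  by rewrite morphimEsub //; apply: (invar_im ibM); apply: set11.
have fE : f @* E = E2 by rewrite /E2 /twin /= (bool_irrelevance (push_aut am) AutNb).
have jN : E * E2 = N := push_join am.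
have nsE2N : E2 <| N := twin_normal am.
have cEE2 (X : {set gT}) : X \subset 'C(E) -> X \subset 'C(E2) -> X \subset 'C(N).
  by move=> cXE cXE2; rewrite -jN centM subsetI cXE.
have maxE : maximal E N := push_maximal am sEN (erefl _).
have iX : invar A 'C_E(M) := Aut_subcent sAE sME iAM.
case: (irrA 'C_E(M)%G (subsetIl _ _) iX) => /= [XE | sXM].
  have cME : M \subset 'C(E) by rewrite centsC -XE subsetIr.
  by apply: cEE2 => //; rewrite -fM -fE morphim_cents.
(* Otherwise [N = E C_N(M)], and [[E, C_N(M)]] lies in [C_E(M)], hence in [M]; then [N] would act
   trivially on [E / M]. *)
have sCE : 'C_N(M) \subset E.
  apply: contraR ncE => nsCE.
  have nsCN : 'C_N(M) <| N by rewrite /normal subsetIl normsI ?normG ?norms_cent ?normal_norm.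
  have EC : E * 'C_N(M) = N.
    by apply: mulg_normal_maximal maxE _ _; rewrite ?subsetIl.
  rewrite -EC comm_mulr_sub //.
  - by rewrite -derg1 /= (Phi_joing pE) joing_subl.
  - apply: subset_trans sXM; rewrite subsetI commg_subl commGC.
    rewrite (subset_trans (subsetIl _ _)) ?normal_norm //=.
    apply: subset_trans (subsetIr N _); rewrite commg_subl.
    exact: subset_trans sEN (normal_norm nsCN).
  by rewrite (subset_trans (subsetIl _ _)) ?normal_norm.
have sCM : 'C_N(M) \subset M.
  by apply: subset_trans sXM; rewrite subsetI sCE subsetIr.
have iNM : #|N : M| = (p ^ 3)%N.
  by rewrite -(Lagrange_index sEN sME) iNE iEM -expnS.
have contra_index : ~ #|N : 'C_N(M)| <= p ^ 2.
  move=> le2; have := leq_trans (dvdn_leq _ (indexgS N sCM)) le2.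
  by rewrite indexg_gt0 iNM leq_exp2l // => /(_ isT).
have [M1 | ntM] := eqVneq (M : {set gT}) 1.
  by apply: subset_trans (sub1G _); rewrite -M1.
have leM : #|M| <= p ^ 3 := card_abelem_push am sMN abM.
pose Z0 := (M :&: 'Z(N))%G; pose Z1 := (M :&: 'Z(E))%G.
have ntZ0 : Z0 :!=: 1 := meet_center_nil (pgroup_nil pN) nsMN ntM.
have sZ01 : Z0 \subset Z1.
  rewrite setIS // subsetI (center_sub_push am).
  by rewrite (subset_trans (subsetIr _ _)) ?centS.
have iZ1 : invar A Z1 by rewrite invarI // (char_invar sAE) ?center_char.
have sZ1M : Z1 \subset M := subsetIl _ _.
have nsZ1N : Z1 <| N := push_invar_normal am (subset_trans sZ1M sME) iZ1.
have cZ1E : Z1 \subset 'C(E) by rewrite subIset // subsetIr orbT.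
have nMZ1 : ~~ (M \subset Z1).
  apply/negP=> sMZ1; have sEM : E \subset M.
    by apply: subset_trans sXM; rewrite subsetI subxx centsC (subset_trans sMZ1).
  by move: sEM; rewrite -indexg_eq1 iEM -(expn0 p) eqn_exp2l.
have [i oZ1] := p_natP (pgroupS sZ1M pM).
have [j iMZ1] := p_natP (pnat_dvd (dvdn_indexg M Z1) pM).
have i0 : 0 < i.
  rewrite lt0n; apply: contraNneq ntZ0 => i0; rewrite -subG1.
  by apply: subset_trans sZ01 _; rewrite subG1 trivg_card1 oZ1 i0.
have j0 : 0 < j.
  by rewrite lt0n; apply: contraNneq nMZ1 => j0; rewrite -indexg_eq1 iMZ1 j0.
have ij3 : i + j <= 3.
  by rewrite -(leq_exp2l _ _ p1) expnD -oZ1 -iMZ1 Lagrange.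
(* Z1 = C_M(E) has index p in M, or order p and index p^2. *)
have [j1 | [i1 j2]] : j = 1%N \/ (i = 1%N /\ j = 2) by clear -i0 j0 ij3; lia.
  have iZ1p : #|M : Z1| = p by rewrite iMZ1 j1 expn1.
  pose Z2 := (f @* Z1)%G.
  have oZ2 : #|Z2| = #|Z1| by rewrite card_injm ?injm_autm // (subset_trans sZ1M).
  have cZ2E2 : Z2 \subset 'C(E2) by rewrite -fE morphim_cents.
  have [m Mm nZm] := subsetPn nMZ1.
  have jM := prime_index_join sZ1M _ Mm nZm.
  (* If [b] fixes [Z1], then [Z1] is central in [N], and [M] is generated over it by one element
     with at most [|Z1| <= p^2] conjugates. Otherwise [M = Z1 Z2] is centralized by [E :&: E2],
     whose index p^2 is too small for a subgroup of [M]. *)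
  have [sZ21 | nsZ21] := boolP (Z2 \subset Z1).
    have eZ2 : Z2 :=: Z1 by apply/eqP; rewrite eqEcard sZ21 oZ2 leqnn.
    have cZN : Z1 \subset 'C(N) by apply: cEE2; rewrite // -eZ2.
    case: contra_index; have cNZ : N \subset 'C(Z1) by rewrite centsC.
    have cmM : 'C_N[m] \subset 'C_N(M) by rewrite (cent1_cycle_cent cNZ) // jM ?iZ1p.
    apply: leq_trans (dvdn_leq _ (indexgS N cmM)) _; rewrite ?indexg_gt0 //.
    apply: (@leq_trans #|Z1|); last by rewrite oZ1 leq_exp2l //; clear -j0 ij3; lia.
    apply: index_cent1_le => q Nq.
    by rewrite (subsetP (prime_index_comm p_pr pN nsMN nsZ1N sZ1M iZ1p)) ?mem_commg.
  have sZ2M : Z2 \subset M by rewrite -fM morphimS.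
  have [m2 Z2m2 nZm2] := subsetPn nsZ21.
  have MZ : M \subset Z2 <*> Z1.
    rewrite -(prime_index_join sZ1M _ (subsetP sZ2M _ Z2m2) nZm2) ?iZ1p //.
    by rewrite genS // setSU // cycle_subG.
  have sDM : E :&: E2 \subset M.
    apply: subset_trans sXM; rewrite subsetI subsetIl centsC (subset_trans MZ) //.
    rewrite join_subG (subset_trans cZ2E2) ?centS ?subsetIr //.
    by rewrite (subset_trans cZ1E) ?centS ?subsetIl.
  have iND : #|N : E :&: E2| = (p ^ 2)%N.
    have := mul_cardG E E2; rewrite jN (card_twin am) -(Lagrange sEN) iNE => oD.
    have sDN : E :&: E2 \subset N by rewrite subIset ?sEN.
    have sDE : E :&: E2 \subset E by apply: subsetIl.
    rewrite -(Lagrange_index sEN sDE) iNE -mulnn; congr (_ * _)%N.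
    apply/eqP; rewrite -(eqn_pmul2l (cardG_gt0 (E :&: E2))) (Lagrange sDE).
    by rewrite -(eqn_pmul2l (cardG_gt0 E)) oD mulnAC -mulnA.
  have := dvdn_leq _ (indexgS N sDM).
  by rewrite indexg_gt0 iNM iND leq_exp2l // => /(_ isT).
have oZ1p : #|Z1| = p by rewrite oZ1 i1 expn1.
have eZ01 : Z0 :=: Z1.
  apply/eqP; rewrite eqEsubset sZ01; apply: contraR ntZ0 => nsZ.
  by rewrite -(setIidPr sZ01) prime_TIg ?oZ1p.
have cZN : Z1 \subset 'C(N) by rewrite -eZ01 subIset // subsetIr orbT.
have fZ1 : f @* Z1 = Z1.
  have /charP[_ fZN] := center_char N.
  by rewrite -eZ01 injmI ?injm_autm // fM fZN ?injm_autm ?im_autm.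
have nsZ1E : Z1 <| E := normalS (subset_trans sZ1M sME) sEN nsZ1N.
have nsME : M <| E := normalS sME sEN nsMN.
have nE := normal_norm nsZ1E.
have iW := quotient_cent_invar sAE nsZ1E sME iZ1 iAM.
(* Otherwise irreducibility puts the centralizer of [M / Z1] in [E] inside [M], so its index is at
   least p^2, while [index_cent_p2] allows at most p. *)
have cEMZ1 : E \subset coset Z1 @*^-1 'C(M / Z1).
  have sWE : E :&: coset Z1 @*^-1 'C(M / Z1) \subset E by apply: subsetIl.
  have [WE | sWM] := irrA (E :&: coset Z1 @*^-1 'C(M / Z1))%G sWE iW.
    by rewrite -{1}WE subsetIr.
  have := index_cent_p2 p_pr (quotient_pgroup Z1 pE) (quotient_normal Z1 nsME).
  rewrite card_quotient ?(subset_trans sME) // iMZ1 j2 leqnn => /(_ isT).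
  rewrite -quotient_setIpre index_quotient_eq //; last first.
    by rewrite setIS // sub_cosetpre.
  move/(leq_trans (dvdn_leq _ (indexgS E sWM))); rewrite indexg_gt0 iEM.
  by rewrite -{2}(expn1 p) leq_exp2l // => /(_ isT).
have sMEZ1 : [~: M, E] \subset Z1.
  by rewrite -quotient_cents2 ?(subset_trans sME) // centsC sub_quotient_pre.
have sME2Z1 : [~: M, E2] \subset Z1.
  by rewrite -fE -fM -fZ1 -morphimR // morphimS.
have sMNZ1 : [~: M, N] \subset Z1.
  rewrite -jN comm_mulr_sub //.
  exact: subset_trans (normal_sub nsE2N) (normal_norm nsZ1N).
(* Choose [m1] and [m2] generating the steps of a chain [Z1 < M1 < M]. Since [[M, N]] lies in [Z1],
   of order p, centralizing each of them costs an index at most p, and whatever centralizes both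
   centralizes [M]. *)
have [eMZ1 | [M1 maxM1 sZM1]] := maximal_exists sZ1M.
  by case/negP: nMZ1; rewrite eMZ1.
have [sM1M _] := andP (maxgroupp maxM1).
have iMM1 : #|M : M1| = p := p_maximal_index pM maxM1.
have iM1Z1 : #|M1 : Z1| = p.
  apply/eqP; rewrite -(eqn_pmul2l p0) -{1}iMM1 Lagrange_index //.
  by rewrite iMZ1 j2 mulnn.
have nM1Z1 : ~~ (M1 \subset Z1) by rewrite -indexg_eq1 iM1Z1 neq_ltn p1 orbT.
have nMM1 : ~~ (M \subset M1) by rewrite -indexg_eq1 iMM1 neq_ltn p1 orbT.
have [[m1 M1m nZm1] [m2 Mm nM1m2]] := (subsetPn nM1Z1, subsetPn nMM1).
have j1 := prime_index_join sZM1 _ M1m nZm1.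
have jj2 := prime_index_join sM1M _ Mm nM1m2.
have cNZ : N \subset 'C(Z1) by rewrite centsC.
have c1 : 'C_N[m1] \subset 'C_N(M1) by rewrite (cent1_cycle_cent cNZ) // j1 ?iM1Z1.
have c1M1 : 'C_N[m1] \subset 'C(M1) := subset_trans c1 (subsetIr _ _).
have c2 : 'C_('C_N[m1])[m2] \subset 'C_N(M).
  apply: subset_trans (_ : 'C_('C_N[m1])(M) \subset _); last first.
    by rewrite setSI ?subsetIl.
  by rewrite (cent1_cycle_cent c1M1) // jj2 ?iMM1.
case: contra_index; apply: leq_trans (dvdn_leq _ (indexgS N c2)) _; rewrite ?indexg_gt0 //.
rewrite -(Lagrange_index (subsetIl N 'C[m1]) (subsetIl _ _)) -mulnn leq_mul //.
  rewrite -oZ1p; apply: index_cent1_le => q Nq.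
  by rewrite (subsetP sMNZ1) ?mem_commg // (subsetP sM1M).
rewrite -oZ1p; apply: index_cent1_le => q /setIP[Nq _].
by rewrite (subsetP sMNZ1) ?mem_commg.
Qed.

End AbelianFrattini.

(** Modulo [Phi(Phi(E))], which [b] preserves by [Phi_invar_twin], the Frattini subgroup is
    elementary abelian and [abelem_Phi_cent] applies. *)
Lemma Phi_comm_sub (gT : finGroupType) p (N E : {group gT}) A b :
  pushing p N E A b -> [~: 'Phi(E), N] \subset 'Phi('Phi(E)).
Proof.
move=> am; pose K := 'Phi('Phi(E))%G.
have pE := pgroupS (normal_sub (push_normal am)) (push_pgroup am).
have sKPhi : K \subset 'Phi(E) := Phi_sub _.
have chK : K \char E := char_trans (Phi_char _) (Phi_char _).
have iAK : invar A K := char_invar (push_Aut am) chK.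
have ibK : invar [set b] K.
  apply: invar_char_trans (push_aut am) _ (Phi_invar_twin am) (Phi_char _).
  exact: subset_trans (Phi_sub _) (normal_sub (push_normal am)).
have [A' [b' [am' _ _ _]]] := push_quotient am sKPhi iAK ibK.
have nsKN : K <| N := push_invar_normal am (subset_trans sKPhi (Phi_sub E)) iAK.
have pPhi : p.-group 'Phi(E) := pgroupS (Phi_sub E) pE.
have nEK := char_norm chK.
have ePhi : 'Phi(E / K) = 'Phi(E) / K by rewrite (quotient_Phi pE).
rewrite -quotient_cents2 ?(normal_norm nsKN) ?(char_norm (Phi_char _)) //.
by rewrite -ePhi (abelem_Phi_cent am') // ePhi Phi_quotient_abelem.
Qed.

(** * Coprime action modulo the Frattini subgroup *)

Section CoprimeAction.

Variables (gT : finGroupType) (p : nat) (P : {group gT}) (B : {group {perm gT}}).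
Hypotheses (p_pr : prime p) (pP : p.-group P).
Hypothesis morphB : forall a, a \in B -> {in P &, {morph a : x y / x * y}}.
Hypothesis trivB : forall a x, a \in B -> x \in P -> x^-1 * a x \in 'Phi(P).

(** Each coset of [Phi(P)] is stable under [B] and has p-power size, so the q-group [B] fixes one of
    its points; the fixed points therefore generate [P]. [B] consists of permutations multiplicative
    on [P], so that automorphisms of a larger group qualify. *)
Lemma qgroup_Phi_fix q : prime q -> q != p -> q.-group B -> B \subset 'C(P | 'P).
Proof.
move=> q_pr neqp qB; pose C := 'Fix_(P | 'P)(B).
have C_group : group_set C.
  apply/group_setP; split=> [|x y /setIP[Px /afixP fx] /setIP[Py /afixP fy]].
    rewrite inE group1; apply/afixP=> a Ba; rewrite /= apermE.
    by apply: (mulgI (a 1)); rewrite -morphB ?mulg1.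
  rewrite inE groupM //; apply/afixP=> a Ba; rewrite /= apermE morphB //.
  by have:= fx a Ba; have:= fy a Ba; rewrite /= !apermE => -> ->.
have fixC x : x \in P -> exists2 y, y \in C & x^-1 * y \in 'Phi(P).
  move=> Px; pose X := x *: 'Phi(P).
  have sXP : X \subset P by rewrite mul_subG ?sub1set ?Phi_sub.
  have actX : [acts B, on X | 'P].
    apply/subsetP=> a Ba; rewrite !inE; apply/subsetP=> y Xy; rewrite inE /= apermE.
    have Py := subsetP sXP y Xy; move: Xy; rewrite !mem_lcoset => Xy.
    by rewrite -[a y](mulKVg y) mulgA groupM ?trivB.
  have := pgroup_fix_mod qB actX; rewrite card_lcoset => eqm.
  have [k oPhi] := p_natP (pgroupS (Phi_sub P) pP).
  have: 0 < #|'Fix_(X | 'P)(B)|.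
    rewrite lt0n; apply: contra neqp => /eqP Fix0; move/eqP: eqm.
    rewrite Fix0 mod0n oPhi -/(q %| p ^ k) Euclid_dvdX // dvdn_prime2 //.
    by case/andP.
  case/card_gt0P=> y /setIP[Xy fy]; exists y; last by rewrite -mem_lcoset.
  by rewrite inE fy (subsetP sXP).
have jC : 'Phi(P) <*> Group C_group = P.
  apply/eqP; rewrite eqEsubset join_subG Phi_sub subsetIl /=.
  apply/subsetP=> x Px; have [y Cy xy] := fixC x Px.
  have -> : x = y * (x^-1 * y)^-1 by rewrite invMg invgK mulKVg.
  by rewrite groupM ?groupV // mem_gen // inE ?xy ?Cy ?orbT.
rewrite astabC; have := Phi_nongen jC; rewrite genGid /= => <-.
exact: subsetIr.
Qed.

End CoprimeAction.

Lemma coprime_Phi_fix (gT : finGroupType) (p : nat) (P : {group gT})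
    (B : {group {perm gT}}) :
    prime p -> p.-group P ->
    {in B, forall a : {perm gT}, {in P &, {morph a : x y / x * y}}} ->
    {in B & P, forall (a : {perm gT}) x, x^-1 * a x \in 'Phi(P)} ->
  p^'.-group B -> {in B & P, forall (a : {perm gT}) x, a x = x}.
Proof.
move=> p_pr pP mB tB p'B; suff sBC: B \subset 'C(P | 'P).
  by move=> a x Ba Px; have := astabP (subsetP sBC a Ba) x Px.
rewrite -(Sylow_gen B) gen_subG; apply/bigcupsP=> Q /SylowP[q q_pr sylQ].
have [sQB qQ _] := and3P sylQ; have sQ := subsetP sQB.
have [Q1 | ntQ] := eqVneq (Q : {set {perm gT}}) 1; first by rewrite Q1 sub1G.
have [_ dvq _] := pgroup_pdiv qQ ntQ.
apply: (@qgroup_Phi_fix gT p P Q) qQ => //.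
- by move=> a /sQ; apply: mB.
- by move=> a x /sQ; apply: tB.
by apply: contraL (dvdn_trans dvq (cardSg sQB)) => /eqP->; rewrite -p'natE.
Qed.

(** * Kernels of actions on sections, and the Frattini quotient *)

Section AutomorphismKernels.

Variables (gT : finGroupType) (E : {group gT}) (G : {group {perm gT}}).
Hypothesis sGE : G \subset Aut E.
Implicit Types X Y : {group gT}.

Definition autker (X Y : {set gT}) := [set a in G | [forall x in X, x^-1 * a x \in Y]].

Lemma autkerP (X Y : {set gT}) a :
  reflect (a \in G /\ {in X, forall x, x^-1 * a x \in Y}) (a \in autker X Y).
Proof.
rewrite inE; apply: (iffP andP) => [] [Ga aXY]; split=> //.
  by move/forall_inP: aXY.
exact/forall_inP.
Qed.

Lemma autker_group_set X Y : invar G X -> group_set (autker X Y).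
Proof.
move=> /invarP iX; apply/group_setP; split.
  by apply/autkerP; split=> // x _; rewrite perm1 mulVg.
move=> a b /autkerP[Ga aXY] /autkerP[Gb bXY]; apply/autkerP; split; first exact: groupM.
by move=> x Xx; rewrite permM -[b _](mulKVg (a x)) mulgA groupM ?aXY ?bXY ?iX.
Qed.

Lemma autker_norm X Y : X \subset E -> invar G X -> invar G Y ->
  G \subset 'N(autker X Y).
Proof.
move=> sXE /invarP iX /invarP iY; apply/subsetP=> g Gg; rewrite inE.
apply/subsetP=> _ /imsetP[a /autkerP[Ga aXY] ->]; apply/autkerP; split.
  exact: groupJ.
have [AutEg AutEa] := (subsetP sGE g Gg, subsetP sGE a Ga).
move=> x Xx; have Xu : g^-1 x \in X by rewrite iX ?groupV.
have Eu := subsetP sXE _ Xu; set u := g^-1 x in Xu Eu.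
have xE : x = g u by rewrite /u permKV.
have gV : g u^-1 = x^-1 by rewrite -(autmE AutEg) morphV //= autmE -xE.
have Eau := Aut_closed AutEa Eu.
rewrite conjgE !permM -/u -gV -(AutM AutEg) ?groupV //.
by apply: iY => //; apply: aXY.
Qed.

End AutomorphismKernels.

(** By Cauchy's theorem it is enough to exclude elements of prime order q different from p; coprime
    action makes them fix [E] pointwise. *)
Lemma autker_pgroup (gT : finGroupType) (p : nat) (E : {group gT})
    (G K : {group {perm gT}}) :
    prime p -> p.-group E -> G \subset Aut E ->
  K \subset autker G E 'Phi(E) -> p.-group K.
Proof.
move=> p_pr pE sGE sK; apply/pgroupP=> q q_pr /(Cauchy q_pr)[a Ka oa].
apply: contraT => nqp.
have /autkerP[Ga aE] := subsetP sK a Ka.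
have sBK : <[a]> \subset K by rewrite cycle_subG.
have sBE c : c \in <[a]> -> c \in Aut E.
  by move=> /(subsetP sBK)/(subsetP sK)/autkerP[Gc _]; apply: (subsetP sGE).
have fixa : {in <[a]> & E, forall (c : {perm gT}) x, c x = x}.
  apply: (@coprime_Phi_fix gT p E <[a]>%G p_pr pE).
  - by move=> c /sBE; apply: AutM.
  - by move=> c x /(subsetP sBK)/(subsetP sK)/autkerP[_]; apply.
  by rewrite /pgroup -orderE oa pnatE.
have a1 : a = 1.
  apply: eq_Aut (sBE a (cycle_id a)) (group1 _) _ => x Ex.
  by rewrite perm1 fixa ?cycle_id.
by move: q_pr; rewrite -oa a1 order1.
Qed.

(** Burnside's basis theorem: representatives of generators of [E / Phi(E)] already generate [E]. *)
Lemma index_Phi_grank (gT : finGroupType) (p : nat) (E : {group gT}) :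
  prime p -> p.-group E -> #|E : 'Phi(E)| = (p ^ 'm(E))%N.
Proof.
move=> p_pr pE; have nPhi := normal_norm (Phi_normal E).
have abV : p.-abelem (E / 'Phi(E)) := Phi_quotient_abelem pE.
rewrite -card_quotient // (card_pgroup (abelem_pgroup abV)); congr (p ^ _)%N.
rewrite -(rank_abelem abV) -grank_abelian ?(abelem_abelian abV) //.
apply/eqP; rewrite eqn_leq quotient_grank //=.
have [B genB <-] := grank_witness (E / 'Phi(E)).
have sBV : B \subset E / 'Phi(E) by rewrite -genB subset_gen.
pose C := (fun xb : coset_of 'Phi(E) => repr xb) @: B.
have CE x : x \in C -> x \in E.
  case/imsetP=> xb Bxb ->; have := subsetP sBV xb Bxb.
  move=> /morphimP[y ny Ey ->] /=; have := mem_repr_coset (coset 'Phi(E) y).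
  rewrite val_coset // => /rcosetP[z Pz ->].
  by rewrite groupM // (subsetP (Phi_sub E)).
have sCE : C \subset E by apply/subsetP.
have eC : <<C>> = E.
  apply: Phi_nongen; apply/eqP; rewrite eqEsubset join_subG Phi_sub sCE /=.
  rewrite -(quotientSGK nPhi) ?joing_subl // -genB gen_subG.
  apply/subsetP=> xb Bxb; rewrite -(coset_reprK xb) mem_quotient //.
  rewrite mem_gen // inE; apply/orP; right.
  exact: (imset_f (fun xb : coset_of 'Phi(E) => repr xb)).
rewrite -{1}eC; apply: leq_trans (grank_min C) _; exact: leq_imset_card.
Qed.

(** * Two transvections producing an inversion *)

Section Transvections.

Variables (gT : finGroupType) (p : nat) (V : {group gT}) (e1 e2 : gT).
Variables (x y : {perm gT}) (k : nat).
Hypotheses (abV : abelian V) (Ve1 : e1 \in V) (Ve2 : e2 \in V).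
Hypothesis genV : <<[set e1; e2]>> = V.
Hypotheses (AutVx : x \in Aut V) (AutVy : y \in Aut V).
Hypotheses (x1 : x e1 = e1) (x2 : x e2 = e2 * e1).
Hypotheses (y2 : y e2 = e2) (y1 : y e1 = e1 * e2 ^+ k).
Hypotheses (e2p : e2 ^+ p = 1) (kp : coprime k p) (p0 : 0 < p).

(* In the basis (e1, e2), [x] and a power of [y] are elementary matrices and
   [w] is the Weyl element, whose square is the scalar -1. *)
Lemma transvections_inversion :
  exists s, let w := x * y ^+ s * x in {in V, forall v, (w * w) v = v^-1}.
Proof.
have AutX n : (y ^+ n) e1 = e1 * e2 ^+ (k * n).
  elim: n => [|n IHn]; first by rewrite expg0 perm1 muln0 mulg1.
  rewrite expgSr permM IHn (AutM AutVy) ?groupX // y1 mulnS expgD mulgA.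
  congr (_ * _); rewrite -(autmE AutVy) morphX //= autmE y2 //.
have y2n n : (y ^+ n) e2 = e2.
  by elim: n => [|n IHn]; rewrite ?expg0 ?perm1 // expgSr permM IHn.
(* The Bezout coefficient [s] satisfies [k s = -1] modulo p. *)
have [s sE] : exists s, e2 ^+ (k * s) = e2^-1.
  have [a _ pa] := Bezoutr k p0; exists a; apply/eqP; rewrite eq_sym eq_invg_mul.
  have /dvdnP[c cE] := pa; rewrite -expgS mulnC -[_.+1]add1n -(eqP kp) cE.
  by rewrite mulnC expgM e2p expg1n.
exists s => w.
have w2 : w e2 = e1.
  rewrite !permM x2 (AutM (groupX s AutVy)) // y2n AutX sE.
  by rewrite (centsP abV e1 Ve1 e2^-1) ?groupV // mulKVg.
have w1 : w e1 = e2^-1.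
  rewrite !permM x1 AutX sE (AutM AutVx) ?groupV // x1.
  rewrite -(autmE AutVx) morphV //= autmE x2 invMg mulKVg //.
have AutVw : w \in Aut V by rewrite !groupM ?groupX.
have AutVww := groupM AutVw AutVw.
pose W := [set v in V | (w * w) v == v^-1].
have W_group : group_set W.
  apply/group_setP; split; first by rewrite inE group1 -(autmE AutVww) morph1 invg1 /=.
  move=> u v /setIdP[Vu /eqP uE] /setIdP[Vv /eqP vE]; rewrite inE groupM //=.
  by rewrite (AutM AutVww) // uE vE invMg (centsP abV u^-1) ?groupV.
have sVW : V \subset Group W_group.
  rewrite -genV gen_subG; apply/subsetP=> v /set2P[] ->; rewrite inE ?Ve1 ?Ve2 /=.
    by rewrite permM w1 -(autmE AutVw) morphV //= autmE w2.
  by rewrite permM w2 w1.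
by move=> v /(subsetP sVW)/setIdP[_ /eqP].
Qed.

End Transvections.

(** * Inversion of the Frattini quotient, and two-generator p-groups *)

Section Inversion.

Variables (gT : finGroupType) (p : nat) (E : {group gT}) (t : {perm gT}).
Hypotheses (p_pr : prime p) (odd_p : odd p) (pE : p.-group E).
Hypothesis AutEt : t \in Aut E.
Hypothesis fixPhi : {in 'Phi(E), t =1 id}.
Hypothesis invE : {in E, forall x, coset 'Phi(E) (t x) = (coset 'Phi(E) x)^-1}.

Lemma odd_square (rT : finGroupType) (H : {group rT}) v :
  odd #[v] -> v ^+ 2 \in H -> v \in H.
Proof.
move=> odd_v Hv2; have : generator <[v]> (v ^+ 2).
  by rewrite generator_coprime coprimen2.
by rewrite -cycle_subG /generator => /eqP->; rewrite cycle_subG.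
Qed.

(** Modulo [Phi(E)] the element [x^-1 * t x] is [x^-2]; as p is odd, [W] covers [E / Phi(E)]. *)
Lemma squares_generate (W : {group gT}) :
    W \subset E -> {in E, forall x, x^-1 * t x \in W} -> W :=: E.
Proof.
move=> sWE tW; rewrite -(genGid W); apply: Phi_nongen; apply/eqP.
rewrite eqEsubset join_subG Phi_sub sWE /=.
have nPhi := normal_norm (Phi_normal E).
rewrite -(quotientSGK nPhi) ?joing_subl // quotientYidl ?(subset_trans sWE) //.
apply/subsetP=> _ /morphimP[x nx Ex ->]; apply: odd_square.
  have oV : odd #|E / 'Phi(E)| by rewrite (odd_pgroup_odd odd_p) ?quotient_pgroup.
  by apply: dvdn_odd oV; rewrite order_dvdG // mem_quotient.
have Etx := Aut_closed AutEt Ex; have nt := subsetP nPhi _ Etx.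
rewrite -groupV expgS expg1 invMg /= -{2}invE // -morphV // -morphM ?groupV //.
by rewrite mem_quotient ?tW.
Qed.

(** For [g] in [Phi(E)], [t] fixes [g] and [g ^ x], so [x] and [t x] conjugate [g] alike. Hence
    every [x^-1 * t x] centralizes [Phi(E)], and these elements generate [E]. *)
Lemma inversion_Phi_central : 'Phi(E) \subset 'Z(E).
Proof.
have nPhi := normal_norm (Phi_normal E).
suff cE : 'C_E('Phi(E)) = E.
  by rewrite subsetI Phi_sub centsC; apply/setIidPl.
apply: (@squares_generate 'C_E('Phi(E))%G (subsetIl _ _)) => x Ex.
have Etx := Aut_closed AutEt Ex.
rewrite /= inE groupM ?groupV //=; apply/centP=> f Pf.
have tJ g : g \in 'Phi(E) -> g ^ t x = g ^ x.
  move=> Pg; have Eg := subsetP (Phi_sub E) g Pg.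
  have Pgx : g ^ x \in 'Phi(E) by rewrite memJ_norm // (subsetP nPhi).
  have tgx : t (g ^ x) = t g ^ t x by rewrite -!(autmE AutEt) morphJ.
  by rewrite -(fixPhi Pgx) tgx (fixPhi Pg).
apply/commute_sym/commgP/conjg_fixP; rewrite conjgM tJ ?conjgKV //.
by rewrite memJ_norm // groupV (subsetP nPhi).
Qed.

(** The inversion lifts from [E / Phi(E)] to [E / E']. On [Phi(E) / E'] it is also the identity, and
    in odd order this forces triviality. *)
Lemma inversion_Phi_der1 : 'Phi(E) = E^`(1).
Proof.
pose D := E^`(1)%G; have chD : D \char E by apply: der_char.
have nD := char_norm chD; have nPhi := normal_norm (Phi_normal E).
have sDPhi : D \subset 'Phi(E) by rewrite (Phi_joing pE) joing_subl.
have abD : abelian (E / D) by apply: sub_der1_abelian.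
have iD : invar [set t] D by apply: char_invar chD; rewrite sub1set.
have [c Autc cE] := Aut_quotient AutEt (char_normal chD) iD.
pose W := [set x in E | c (coset D x) == (coset D x)^-1].
have W_group : group_set W.
  apply/group_setP; split.
    by rewrite inE group1 morph1 invg1 -(autmE Autc) morph1 /=.
  move=> u v /setIdP[Eu /eqP uE] /setIdP[Ev /eqP vE]; rewrite inE groupM //=.
  have [nu nv] := (subsetP nD u Eu, subsetP nD v Ev).
  rewrite morphM // (AutM Autc) ?mem_quotient // uE vE invMg.
  by rewrite (centsP abD (coset D u)^-1) ?groupV ?mem_quotient.
have WE : Group W_group :=: E.
  apply: squares_generate => [|x Ex]; first by apply/subsetP=> x /setIdP[].
  have Etx := Aut_closed AutEt Ex; have Ettx := Aut_closed AutEt Etx.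
  have [nx ntx] := (subsetP nD x Ex, subsetP nD _ Etx).
  have nttx := subsetP nD _ Ettx.
  rewrite inE groupM ?groupV //= cE ?groupM ?groupV //.
  (* From [t x = x^-1 * f] comes [t (t x) = x ^ f], congruent to [x] modulo [E']; so [t] inverts
     [x^-1 * t x] modulo [E']. *)
  have [f Pf txE] : exists2 f, f \in 'Phi(E) & t x = x^-1 * f.
    exists (x * t x); last by rewrite mulKg.
    rewrite coset_idr ?groupM ?(subsetP nPhi) //.
    by rewrite morphM ?(subsetP nPhi) //= invE // mulgV.
  have Ef := subsetP (Phi_sub E) f Pf.
  have tV : t x^-1 = (t x)^-1 by rewrite -!(autmE AutEt) morphV.
  have ttx : t (t x) = x ^ f.
    by rewrite {1}txE (AutM AutEt) ?groupV // (fixPhi Pf) tV txE invMg invgK conjgE mulgA.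
  have nf := subsetP nD f Ef.
  have cxf := centsP abD _ (mem_quotient D Ex) _ (mem_quotient D Ef).
  rewrite (AutM AutEt) ?groupV // tV ttx conjgE !morphM ?groupM ?groupV //=.
  by rewrite !morphV //= cxf mulKg invMg invgK.
apply/eqP; rewrite eqEsubset sDPhi andbT; apply/subsetP=> f Pf.
have Ef := subsetP (Phi_sub E) f Pf; have: f \in Group W_group by rewrite WE.
case/setIdP=> _; rewrite cE // fixPhi // => /eqP fV.
have [nf oV] : f \in 'N(D) /\ odd #|E / D|.
  by split; [apply: (subsetP nD) | rewrite (odd_pgroup_odd odd_p) ?quotient_pgroup].
apply: coset_idr => //; apply/set1gP; apply: odd_square.
  by apply: dvdn_odd oV; rewrite order_dvdG // mem_quotient.
by rewrite expgS expg1 {1}fV mulVg group1.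
Qed.

End Inversion.

(** The commutator [c] of two generators is central, so [E / <[c]>] is abelian; and [c^p = [x, y^p]]
    is trivial because [y^p] lies in [Phi(E)], hence in the center. *)
Lemma card_der1_2gen (gT : finGroupType) (p : nat) (E : {group gT}) :
    prime p -> p.-group E -> 'm(E) = 2 -> 'Phi(E) \subset 'Z(E) -> #|E^`(1)| <= p.
Proof.
move=> p_pr pE mE sPZ; have [B genB] := grank_witness E; rewrite mE.
move=> /eqP/cards2P[x [y [_ eB]]].
have sBE : B \subset E by rewrite -genB subset_gen.
have [Ex Ey] : x \in E /\ y \in E 
  by split; apply: (subsetP sBE); rewrite eB !inE eqxx ?orbT.
pose c := [~ x, y]; have Z1 : E^`(1) \subset 'Z(E).
  by apply: subset_trans sPZ; rewrite (Phi_joing pE) joing_subl.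
have Zc : c \in 'Z(E) by rewrite (subsetP Z1) // mem_commg.
have nc : E \subset 'N(<[c]>).
  by rewrite cents_norm // centsC cycle_subG (subsetP (subsetIr E _)).
have yp : y ^+ p \in 'Phi(E).
  have nPhi := normal_norm (Phi_normal E).
  rewrite coset_idr ?groupX ?(subsetP nPhi) // morphX ?(subsetP nPhi) //.
  have /(abelemP p_pr)[_ ->] // := Phi_quotient_abelem pE.
  exact: mem_quotient.
have cc z : z \in E -> commute z c.
  by move=> Ez; case/setIP: Zc => _ /centP/(_ z Ez)/commute_sym.
have cp : c ^+ p = 1.
  rewrite -commgX; last exact: cc.
  apply/eqP/commgP/commute_sym.
  by case/setIP: (subsetP sPZ _ yp) => _ /centP; apply.
have oc : #|<[c]>| <= p by rewrite -orderE dvdn_leq ?prime_gt0 // order_dvdn cp.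
have sBn := subset_trans sBE nc.
apply: leq_trans (subset_leq_card _) oc; apply: der1_min nc _.
rewrite -genB (quotient_gen sBn) abelian_gen.
apply: quotient_cents2r; rewrite gen_subG; apply/subsetP=> _ /imset2P[u v + + ->].
rewrite eB => /set2P[] -> /set2P[] ->; rewrite ?commgg ?group1 ?cycle_id //.
by rewrite -invg_comm groupV cycle_id.
Qed.

(** If [R] lies in [H], it lies in every conjugate of [H]. Otherwise a Sylow subgroup [P] of [H] is
    proper in the p-group [R P], so some [g] outside [P] normalizes it there; [g] is outside [H],
    and [P] lies in [H] and in its conjugate by [g]. *)
Lemma strongly_embedded_pcore (gT : finGroupType) (p : nat) (X H R : {group gT}) :
    prime p -> strongly_p_embedded p X H -> R <| X -> p.-group R -> R :=: 1.
Proof.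
move=> p_pr [prHX pH embH] nsRX pR; have [sHX _] := andP prHX.
have [sRX nRX] := andP nsRX; apply/eqP; apply: contraT => ntR.
have [P sylP] := Sylow_exists p H; have [sPH pP _] := and3P sylP.
have ntP : P :!=: 1.
  by rewrite -cardG_gt1 (card_Hall sylP) p_part_gt1 mem_primes p_pr cardG_gt0.
have pdvd (Q : {group gT}) : p.-group Q -> Q :!=: 1 -> p %| #|Q|.
  by move=> pQ /(pgroup_pdiv pQ)[].
have [sRH | nsRH] := boolP (R \subset H).
  have [g Xg nHg] := subsetPn (proj2 (andP prHX)).
  have /embH/negP[] : g \in X :\: H by rewrite inE nHg.
  apply: dvdn_trans (pdvd R pR ntR) (cardSg _).
  by rewrite subsetI sRH -{1}(normsP nRX g Xg) conjSg.
have nRP : P \subset 'N(R) := subset_trans sPH (subset_trans sHX nRX).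
pose Q := (R <*> P)%G; have pQ : p.-group Q by rewrite /= norm_joinEr // pgroupM pR.
have prPQ : P \proper Q.
  rewrite properE joing_subr; apply: contra nsRH => sQP.
  exact: subset_trans (joing_subl R P) (subset_trans sQP sPH).
have [sPN /subsetPn[g /setIP[Qg Ng] nPg]] := andP (nilpotent_proper_norm (pgroup_nil pQ) prPQ).
have sQX : Q \subset X by rewrite join_subG sRX (subset_trans sPH).
have nHg : g \notin H.
  apply: contra nPg => Hg.
  have pHQ : p.-group (H :&: Q) by apply: pgroupS pQ; apply: subsetIr.
  have sPHQ : P \subset H :&: Q by rewrite subsetI sPH (proper_sub prPQ).
  have <- : H :&: Q = P by apply: sub_pHall sylP _ sPHQ _ => //; apply: subsetIl.
  by rewrite inE Hg.
have /embH/negP[] : g \in X :\: H by rewrite inE nHg (subsetP sQX).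
apply: dvdn_trans (pdvd P pP ntP) (cardSg _).
by rewrite subsetI sPH -{1}(normP Ng) conjSg.
Qed.

(** * Essential subgroups of rank two *)

Section RankTwo.

Variables (gT : finGroupType) (p : nat) (N E : {group gT}) (G : {group {perm gT}}).
Hypotheses (p_pr : prime p) (pN : p.-group N) (nsEN : E <| N).
Hypotheses (sCE : 'C_N(E) \subset E) (nsNE : ~~ (N \subset E)).
Hypotheses (sGE : G \subset Aut E) (sNG : conj_aut E @* N \subset G).
Hypothesis coreG : forall R : {group {perm gT}},
  R <| G -> p.-group R -> R \subset conj_aut E @* E.
Hypothesis mE : 'm(E) = 2.

Let sEN := normal_sub nsEN.
Let nEN := normal_norm nsEN.
Let pE := pgroupS sEN pN.
Let nPhi := normal_norm (Phi_normal E).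
Let p1 := prime_gt1 p_pr.

Let iPhi : #|E : 'Phi(E)| = (p ^ 2)%N.
Proof. by rewrite (index_Phi_grank p_pr pE) mE. Qed.

Let nPhiN : N \subset 'N('Phi(E)).
Proof. exact: char_norm_trans (Phi_char E) nEN. Qed.

Lemma conj_autG n : n \in N -> conj_aut E n \in G.
Proof.
move=> Nn; apply: (subsetP sNG); apply: mem_morphim => //.
exact: (subsetP nEN).
Qed.

Lemma conj_autN n x : n \in N -> x \in E -> conj_aut E n x = x ^ n.
Proof. by move=> Nn Ex; rewrite norm_conj_autE // (subsetP nEN). Qed.

Lemma inner_mem n : n \in N -> conj_aut E n \in conj_aut E @* E -> n \in E.
Proof.
move=> Nn /morphimP[e ne Ee eq_ne].
have Ne := subsetP sEN e Ee.
suff Cne : n * e^-1 \in E by rewrite -(groupMr n (groupVr Ee)).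
apply: (subsetP sCE); rewrite inE groupM ?groupV //=; apply/centP=> x Ex.
apply/commute_sym/commgP/conjg_fixP.
by rewrite conjgM -(conj_autN Nn Ex) eq_ne /= (conj_autN Ne Ex) conjgK.
Qed.

Lemma no_normal_pgroup (R : {group {perm gT}}) :
  R <| G -> p.-group R -> ~~ (conj_aut E @* N \subset R).
Proof.
move=> nsRG pR; apply: contra nsNE => sNR; apply/subsetP=> n Nn.
apply: inner_mem => //; apply: (subsetP (coreG nsRG pR)); apply: (subsetP sNR).
by apply: mem_morphim => //; apply: (subsetP nEN).
Qed.

Lemma invPhi : invar G 'Phi(E).
Proof. exact: char_invar sGE (Phi_char E). Qed.

Lemma invE : invar G E.
Proof. exact: char_invar sGE (char_refl E). Qed.

Lemma autker_normal (X Y : {group gT}) :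
    X \subset E -> invar G X -> invar G Y ->
  exists2 R : {group {perm gT}}, R :=: autker G X Y & R <| G.
Proof.
move=> sXE iX iY; exists (Group (autker_group_set Y iX)) => //.
rewrite /normal (autker_norm sGE) // andbT.
by apply/subsetP=> a /autkerP[].
Qed.

(** The automorphisms trivial on [E / Phi(E)] form a normal p-subgroup of [G], to which [coreG]
    applies. *)
Lemma autker_inner a : a \in autker G E 'Phi(E) -> a \in conj_aut E @* E.
Proof.
have [R defR nsRG] := autker_normal (subxx E) invE invPhi.
rewrite -defR; apply: (subsetP (coreG nsRG _)).
by apply: (autker_pgroup p_pr pE sGE); rewrite defR.
Qed.

Lemma faithful_mem n :
  n \in N -> {in E, forall x, [~ x, n] \in 'Phi(E)} -> n \in E.
Proof.
move=> Nn cn; apply: (inner_mem Nn); apply: autker_inner.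
apply/autkerP; split; first exact: conj_autG.
by move=> x Ex; rewrite conj_autN // -commgEl cn.
Qed.

(** [N / E] acts faithfully on [E / Phi(E)], of order p^2, and a p-group induces at most p
    automorphisms there. *)
Lemma index_NE : #|N : E| = p.
Proof.
have sCV : 'C_(N / 'Phi(E))(E / 'Phi(E)) \subset E / 'Phi(E).
  apply/subsetP=> _ /setIP[/morphimP[n nn Nn ->] /centP cn].
  apply: mem_quotient; apply: faithful_mem => // x Ex.
  have nx := subsetP nPhi x Ex.
  rewrite coset_idr ?groupR // morphR //; apply/eqP/commgP/commute_sym.
  by apply: cn; rewrite mem_quotient.
have nsV : E / 'Phi(E) <| N / 'Phi(E) by apply: quotient_normal.
have := index_cent_p2 p_pr (quotient_pgroup _ pN) nsV.
rewrite card_quotient // iPhi leqnn => /(_ isT).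
move/(leq_trans (dvdn_leq (indexg_gt0 _ _) (indexgS _ sCV))).
rewrite index_quotient_eq //; last by rewrite subIset // Phi_sub orbT.
have [k iNE] := p_natP (pnat_dvd (dvdn_indexg N E) pN); rewrite iNE => lekp.
have k0 : 0 < k.
  by rewrite lt0n; apply: contra nsNE => /eqP k0; rewrite -indexg_eq1 iNE k0.
move: lekp; rewrite -{2}(expn1 p) leq_exp2l // => lek.
have -> : k = 1%N by apply/eqP; rewrite eqn_leq lek.
by rewrite expn1.
Qed.

(** The preimage of the fixed space of [N] on the plane [E / Phi(E)], that is, of the axis of the
    transvections induced by [N]. *)
Definition line : {group gT} := (E :&: coset 'Phi(E) @*^-1 'C(N / 'Phi(E)))%G.

Lemma line_comm : [~: line, N] \subset 'Phi(E).
Proof.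
rewrite -quotient_cents2 ?(subset_trans (subsetIl E _)) //.
by rewrite /= quotient_setIpre subsetIr.
Qed.

Lemma comm_line x : x \in E -> {in N, forall n, [~ x, n] \in 'Phi(E)} -> x \in line.
Proof.
move=> Ex cx; have nx := subsetP nPhi x Ex; rewrite inE Ex.
apply/morphpreP; split=> //; apply/centP=> _ /morphimP[n nn Nn ->].
by apply/commgP; rewrite -morphR //= coset_id ?cx.
Qed.

Lemma Phi_sub_line : 'Phi(E) \subset line.
Proof. by rewrite subsetI Phi_sub sub_cosetpre. Qed.

Lemma line_proper : ~~ (E \subset line).
Proof.
apply: contra nsNE => sEL; apply/subsetP=> n Nn; apply: faithful_mem => // x Ex.
by rewrite (subsetP line_comm) // mem_commg ?(subsetP sEL).
Qed.

Lemma Phi_proper_line : ~~ (line \subset 'Phi(E)).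
Proof.
have nilV : nilpotent (N / 'Phi(E)) by rewrite quotient_nil // (pgroup_nil pN).
have ntV : E / 'Phi(E) != 1.
  by rewrite -cardG_gt1 card_quotient // iPhi -(expn0 p) ltn_exp2l.
have := meet_center_nil nilV (quotient_normal _ nsEN) ntV.
apply: contra => sLP; rewrite -subG1 -(quotientS1 sLP).
by rewrite /= quotient_setIpre setIS // subsetIr.
Qed.

Lemma index_Phi_between (X : {group gT}) :
    'Phi(E) \subset X -> X \subset E ->
    ~~ (X \subset 'Phi(E)) -> ~~ (E \subset X) ->
  #|X : 'Phi(E)| = p /\ #|E : X| = p.
Proof.
move=> sPX sXE nsXP nsEX; have := Lagrange_index sXE sPX; rewrite iPhi.
have [k kE] := p_natP (pnat_dvd (dvdn_indexg E X) pE).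
have [l lE] := p_natP (pnat_dvd (dvdn_indexg X 'Phi(E)) (pgroupS sXE pE)).
have k0 : k != 0%N by apply: contraNneq nsEX => k0; rewrite -indexg_eq1 kE k0.
have l0 : l != 0%N by apply: contraNneq nsXP => l0; rewrite -indexg_eq1 lE l0.
rewrite kE lE -expnD => /eqP; rewrite eqn_exp2l // => /eqP kl.
by have [-> ->] : k = 1%N /\ l = 1%N by clear -k0 l0 kl; lia.
Qed.

Lemma index_line : #|line : 'Phi(E)| = p /\ #|E : line| = p.
Proof.
apply: index_Phi_between Phi_sub_line _ Phi_proper_line line_proper.
exact: subsetIl.
Qed.

Lemma line_normal : line <| N.
Proof.
rewrite /normal (subset_trans (subsetIl _ _) sEN) -commg_subl.
exact: subset_trans line_comm Phi_sub_line.
Qed.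

Lemma comm_sub_line : [~: E, N] \subset line.
Proof.
have [_ iEL] := index_line.
exact: prime_index_comm p_pr pN nsEN line_normal (subsetIl _ _) iEL.
Qed.

(** If [a] is trivial on both factors of the chain from [E] through [line] to [Phi(E)], then
    [a ^+ p] is trivial on [E / Phi(E)], hence inner and of p-power order. *)
Lemma chain_pgroup (R : {group {perm gT}}) :
  R \subset autker G E line -> R \subset autker G line 'Phi(E) -> p.-group R.
Proof.
move=> sRE sRL; apply/pgroupP=> q q_pr /(Cauchy q_pr)[a Ra oa].
have /autkerP[Ga aE] := subsetP sRE a Ra; have /autkerP[_ aL] := subsetP sRL a Ra.
have AutEa := subsetP sGE a Ga.
have [c Autc cE] := Aut_quotient AutEa (Phi_normal E) (invar1 Ga invPhi).
have sLE : line \subset E := subsetIl _ _.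
have cV : {in line / 'Phi(E), forall z, c z = z}.
  move=> _ /morphimP[x nx Lx ->] /=; have Ex := subsetP sLE x Lx.
  rewrite cE // -[a x](mulKVg x) coset_kerr //; exact: aL.
have aX k x : x \in E -> coset 'Phi(E) ((a ^+ k) x)
    = coset 'Phi(E) x * coset 'Phi(E) (x^-1 * a x) ^+ k.
  move=> Ex; have Lz := aE x Ex; set z := x^-1 * a x in Lz *.
  have Vz : coset 'Phi(E) z \in line / 'Phi(E) by apply: mem_quotient.
  have Ez := subsetP sLE z Lz; have sV := quotientS 'Phi(E) sLE.
  elim: k => [|k IHk]; first by rewrite !expg0 perm1 mulg1.
  rewrite expgSr permM -cE ?(Aut_closed (groupX k AutEa)) // IHk.
  rewrite (AutM Autc) ?mem_quotient ?groupX ?(subsetP sV) //.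
  rewrite (cV _ (groupX k Vz)) (cE x Ex).
  rewrite -{1}[a x](mulKVg x) -/z morphM ?(subsetP nPhi) //=.
  by rewrite -mulgA -expgS.
have ap : a ^+ p \in conj_aut E @* E.
  apply: autker_inner; apply/autkerP; split; first exact: groupX.
  move=> x Ex; have Ez := subsetP sLE _ (aE x Ex).
  have Eax := Aut_closed (groupX p AutEa) Ex.
  rewrite coset_idr ?groupM ?groupV ?(subsetP nPhi) //.
  rewrite morphM ?groupV ?(subsetP nPhi) //= aX // morphV ?(subsetP nPhi) //= mulKg.
  have /(abelemP p_pr)[_ ->] // := Phi_quotient_abelem pE.
  exact: mem_quotient.
have pI : p.-group (conj_aut E @* E) by apply: morphim_pgroup.
have := mem_p_elt pI ap; rewrite /p_elt; apply: contraLR => nqp.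
have cop : coprime q p by rewrite prime_coprime // dvdn_prime2.
rewrite orderXgcd oa (eqP cop) divn1 pnatE //.
Qed.

(** Otherwise the automorphisms trivial on [E / line] and on [line / Phi(E)] form a normal
    p-subgroup containing those induced by [N], against [no_normal_pgroup]. *)
Lemma line_moves : ~~ invar G line.
Proof.
apply/negP=> iL; have sLE : line \subset E := subsetIl _ _.
have [R1 defR1 nsR1] := autker_normal (subxx E) invE iL.
have [R2 defR2 nsR2] := autker_normal sLE iL invPhi.
have nsR : R1 :&: R2 <| G by apply: normalI.
have pR : p.-group (R1 :&: R2).
  by apply: chain_pgroup; rewrite -?defR1 -?defR2 ?subsetIl ?subsetIr.
case/negP: (no_normal_pgroup nsR pR); apply/subsetP=> _ /morphimP[n nn Nn ->].
rewrite inE defR1 defR2; apply/andP; split; apply/autkerP; rewrite conj_autG //; split=> // x.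
  move=> Ex; rewrite conj_autN // -commgEl.
  by rewrite (subsetP comm_sub_line) ?mem_commg.
move=> Lx; have Ex := subsetP sLE x Lx.
by rewrite conj_autN // -commgEl (subsetP line_comm) ?mem_commg.
Qed.

(** A counterexample yields an invariant [J = Phi(E) X] of index p in [E]. Being normal in [N], it
    is centralized by [N] modulo [Phi(E)], so it equals [line], which [G] moves. *)
Lemma irreducible (X : {group gT}) :
  X \subset E -> invar G X -> X :=: E \/ X \subset 'Phi(E).
Proof.
move=> sXE iX; have [sXP | nsXP] := boolP (X \subset 'Phi(E)); [by right | left].
rewrite -(genGid X); apply: Phi_nongen; apply/eqP.
rewrite eqEsubset join_subG Phi_sub sXE /=; apply: contraR line_moves => nsEJ.
pose J := ('Phi(E) <*> X)%G.
have sJE : J \subset E by rewrite join_subG Phi_sub sXE.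
have sPJ : 'Phi(E) \subset J := joing_subl _ _.
have iJ : invar G J.
  apply/invarP=> a Ga x; have AutEa := subsetP sGE a Ga.
  have -> : J :=: 'Phi(E) * X by rewrite /= norm_joinEr // (subset_trans sXE).
  case/mulsgP=> f y Pf Xy ->; have Ey := subsetP sXE y Xy.
  have Ef := subsetP (Phi_sub E) f Pf.
  rewrite (AutM AutEa Ef Ey); apply: mem_mulg.
    exact: (invarP invPhi) a Ga f Pf.
  exact: (invarP iX) a Ga y Xy.
suff -> : line :=: J by [].
have [iLP _] := index_line.
have [iJP _] : #|J : 'Phi(E)| = p /\ #|E : J| = p.
  apply: index_Phi_between => //; apply: contra nsXP; apply: subset_trans.
  exact: joing_subr.
have nsJN : J <| N.
  rewrite /normal (subset_trans sJE sEN); apply/normsP=> n Nn; apply/eqP.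
  rewrite eqEcard cardJg leqnn andbT; apply/subsetP=> _ /imsetP[x Jx ->].
  rewrite -(conj_autN Nn) ?(subsetP sJE) //; apply: (invarP iJ) => //.
  exact: conj_autG.
have nsPN : 'Phi(E) <| N by rewrite /normal nPhiN (subset_trans (Phi_sub E)).
have cJN := prime_index_comm p_pr pN nsJN nsPN sPJ iJP.
apply/eqP; rewrite eq_sym eqEcard -(Lagrange sPJ) -(Lagrange Phi_sub_line) iJP iLP leqnn andbT.
apply/subsetP=> x Jx; apply: comm_line; first exact: (subsetP sJE).
by move=> n Nn; rewrite (subsetP cJN) ?mem_commg.
Qed.

(** Conjugating a transvection [x] induced by [N] by some [g] that moves [line] gives [y] in [K]
    with a different axis; [transvections_inversion] then applies on [E / Phi(E)]. *)
Lemma normal_inversion (K : {group {perm gT}}) :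
    K <| G -> conj_aut E @* N \subset K ->
  exists2 w, w \in K
    & {in E, forall v, coset 'Phi(E) (w v) = (coset 'Phi(E) v)^-1}.
Proof.
move=> nsKG sNK; have [sKG nKG] := andP nsKG; have [iLP iEL] := index_line.
have sLE : line \subset E := subsetIl _ _; have sPL := Phi_sub_line.
have [n Nn nEn] := subsetPn nsNE.
have Kn m : m \in N -> conj_aut E m \in K.
  by move=> Nm; apply: (subsetP sNK); apply: mem_morphim => //; apply: (subsetP nEN).
have [g Gg [l0 Ll0 nLgl0]] : exists2 g, g \in G & exists2 l0, l0 \in line & g l0 \notin line.
  have := line_moves; rewrite negb_forall_in => /exists_inP[g Gg].
  by case/subsetPn=> _ /imsetP[l0 Ll0 ->] nL; exists g => //; exists l0.
have AutEg := subsetP sGE g Gg.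
pose x := conj_aut E n; pose y := x ^ g.
have Kx : x \in K by apply: Kn.
have Ky : y \in K by rewrite memJ_norm ?(subsetP nKG).
have AutEx := subsetP sGE x (subsetP sKG x Kx).
have AutEy := subsetP sGE y (subsetP sKG y Ky).
have El0 := subsetP sLE l0 Ll0; have Egl0 := Aut_closed AutEg El0.
have pr_EL : prime #|E : line| by rewrite iEL.
have pr_LP : prime #|line : 'Phi(E)| by rewrite iLP.
have jE := prime_index_join sLE pr_EL Egl0 nLgl0.
have gPhi v : (g v \in 'Phi(E)) = (v \in 'Phi(E)).
  by rewrite -{1}(invar_im invPhi Gg) mem_imset //; apply: perm_inj.
have nPl0 : l0 \notin 'Phi(E).
  by apply: contra nLgl0; rewrite -gPhi; apply: (subsetP sPL).
have jL := prime_index_join sPL pr_LP Ll0 nPl0.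
(* The single element [n] fixes no more than [line]: with a further fixed vector it would act
   trivially on [E / Phi(E)]. *)
have centn v : v \in E -> [~ v, n] \in 'Phi(E) -> v \in line.
  move=> Ev cvn; apply: contraR nEn => nLv.
  pose M := (E :&: coset 'Phi(E) @*^-1 'C[coset 'Phi(E) n])%G.
  have memM u : u \in E -> (u \in M) = ([~ u, n] \in 'Phi(E)).
    move=> Eu; have [nu nn] := (subsetP nPhi u Eu, subsetP nPhiN n Nn).
    rewrite inE Eu; apply/morphpreP/idP=> [[_ /cent1P cun] | cun].
      by rewrite coset_idr ?groupR // morphR //; apply/eqP/commgP/commute_sym.
    split=> //; apply/cent1P/commgP.
    by rewrite -morphR //= coset_id.
  apply: faithful_mem => // u Eu; rewrite -memM //; apply: (subsetP _ u Eu).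
  rewrite -(prime_index_join sLE pr_EL Ev nLv) join_subG cycle_subG memM // cvn.
  apply/subsetP=> z Lz; rewrite memM ?(subsetP sLE) //.
  by rewrite (subsetP line_comm) ?mem_commg.
(* A basis adapted to both axes: [g l0] spans that of [y], and [l1], the displacement of [g l0]
   under [x], spans [line]. *)
pose l1 := [~ g l0, n].
have Ll1 : l1 \in line by rewrite (subsetP comm_sub_line) ?mem_commg.
have nPl1 : l1 \notin 'Phi(E) by apply: contra nLgl0; apply: centn.
have jL1 := prime_index_join sPL pr_LP Ll1 nPl1.
have El1 := subsetP sLE l1 Ll1.
have xE v : v \in E -> x v = v * [~ v, n].
  by move=> Ev; rewrite /x conj_autN // commgEl mulKVg.
have yE v : v \in E -> y v = v * g [~ g^-1 v, n].
  move=> Ev; have Eu : g^-1 v \in E by rewrite (Aut_closed (groupVr AutEg)).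
  have Ec : [~ g^-1 v, n] \in E.
    by rewrite (subsetP sLE) // (subsetP comm_sub_line) ?mem_commg.
  by rewrite /y conjgE !permM xE // (AutM AutEg Eu Ec) permKV.
pose u := g^-1 l1; have Eu : u \in E by rewrite (Aut_closed (groupVr AutEg)).
have Lc : [~ u, n] \in line by rewrite (subsetP comm_sub_line) ?mem_commg.
have nPc : [~ u, n] \notin 'Phi(E).
  apply: contra nLgl0 => /(centn u Eu) Lu.
  pose gL := (autm AutEg @* line)%G.
  have gLE : gL :=: g @: line by rewrite /= morphimEsub.
  have sPgL : 'Phi(E) \subset gL.
    by rewrite gLE -(invar_im invPhi Gg) imsetS.
  have sLgL : line \subset gL.
    rewrite -jL1 join_subG sPgL cycle_subG andbT gLE.
    by apply/imsetP; exists u; rewrite // /u permKV.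
  have eL : line :=: gL.
    have oL : #|gL| = #|line| by apply: card_injm; rewrite ?injm_autm.
    by apply/eqP; rewrite eqEcard sLgL oL leqnn.
  by rewrite eL gLE imset_f.
(* The displacement of [l1] under [y] is [g [~ u, n]], that is, [g l0 ^+ k] modulo [Phi(E)]; [k] is
   prime to p because [[~ u, n]] is not in [Phi(E)]. *)
have [k [f Pf cE]] : exists k, exists2 f, f \in 'Phi(E) & [~ u, n] = l0 ^+ k * f.
  have: [~ u, n] \in <[l0]> * 'Phi(E).
    by rewrite -norm_joinEl ?jL // cycle_subG (subsetP nPhi).
  by case/mulsgP=> _ f /cycleP[k ->] Pf ->; exists k; exists f.
have Ef := subsetP (Phi_sub E) f Pf.
have gcE : g [~ u, n] = g l0 ^+ k * g f.
  by rewrite cE (AutM AutEg) ?groupX // -(autmE AutEg) morphX.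
pose V := (E / 'Phi(E))%G; pose e1 := coset 'Phi(E) l1; pose e2 := coset 'Phi(E) (g l0).
have abV : p.-abelem V := Phi_quotient_abelem pE.
have [cx Autcx cxE] := Aut_quotient AutEx (Phi_normal E) (invar1 (subsetP sKG x Kx) invPhi).
have [cy Autcy cyE] := Aut_quotient AutEy (Phi_normal E) (invar1 (subsetP sKG y Ky) invPhi).
have Ve1 : e1 \in V by apply: mem_quotient.
have Ve2 : e2 \in V by apply: mem_quotient.
have genV : <<[set e1; e2]>> = V.
  apply/eqP; rewrite eqEsubset gen_subG subUset !sub1set Ve1 Ve2 /=.
  have sW : <<[set l1; g l0]>> \subset E by rewrite gen_subG subUset !sub1set El1.
  have genU : <<[set l1; g l0]>> = E.
    rewrite -[RHS](Phi_nongen (X := <<[set l1; g l0]>>)) ?genGid //.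
    apply/eqP; rewrite eqEsubset join_subG Phi_sub sW /= -{1}jE -{1}jL1.
    rewrite !join_subG !cycle_subG joing_subl andbT.
    by rewrite !mem_gen // inE mem_gen ?orbT // !inE eqxx ?orbT.
  have sVU : V \subset <<[set l1; g l0]>> / 'Phi(E) by rewrite genU.
  apply: subset_trans sVU _.
  rewrite quotient_gen ?subUset ?sub1set ?(subsetP nPhi) //.
  rewrite genS //; apply/subsetP=> _ /morphimP[z _ /set2P[] -> ->]; rewrite !inE ?eqxx //.
  by rewrite orbT.
have nP v : v \in E -> v \in 'N('Phi(E)) by apply: (subsetP nPhi).
have x1 : cx e1 = e1.
  by rewrite cxE // xE // coset_kerr // (subsetP line_comm) ?mem_commg.
have x2 : cx e2 = e2 * e1 by rewrite cxE // xE // morphM ?nP.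
have y2 : cy e2 = e2.
  by rewrite cyE // yE // permK coset_kerr // gPhi (subsetP line_comm) ?mem_commg.
have y1 : cy e1 = e1 * e2 ^+ k.
  have Pgf : g f \in 'Phi(E) by rewrite gPhi.
  rewrite cyE // yE // -/u gcE mulgA (coset_kerr _ Pgf).
  rewrite -[RHS](_ : coset 'Phi(E) (l1 * g l0 ^+ k) = _) //.
  by rewrite -[e2 ^+ k]morphX ?nP //; apply: morphM; rewrite ?groupX ?nP.
have [abelV expV] := abelemP p_pr abV.
have kp : coprime k p.
  rewrite coprime_sym prime_coprime //; apply: contra nPc => /dvdnP[q kE].
  rewrite -gPhi gcE groupM ?gPhi // coset_idr ?groupX ?nP // morphX ?nP //=.
  by rewrite kE mulnC expgM expV // expg1n.
have [s] := transvections_inversion abelV Ve1 Ve2 genV Autcx Autcy x1 x2 y2 y1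
  (expV _ Ve2) kp (prime_gt0 p_pr).
set cw := cx * cy ^+ s * cx => invV.
pose w := x * y ^+ s * x.
have AutEys := groupX s AutEy.
have cysE v : v \in E -> (cy ^+ s) (coset 'Phi(E) v) = coset 'Phi(E) ((y ^+ s) v).
  move=> Ev; elim: (s) => [|j IHj]; first by rewrite !expg0 !perm1.
  have Ejv := Aut_closed (groupX j AutEy) Ev.
  by rewrite !expgSr [LHS]permM IHj cyE // [in RHS]permM.
have cwE v : v \in E -> cw (coset 'Phi(E) v) = coset 'Phi(E) (w v).
  move=> Ev; have Exv := Aut_closed AutEx Ev.
  by rewrite !permM cxE // cysE // cxE // (Aut_closed AutEys).
have AutEw : w \in Aut E by rewrite !groupM.
exists (w * w) => [|v Ev]; first by rewrite !groupM ?groupX.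
rewrite -invV ?mem_quotient // [(cw * cw) _]permM [(w * w) _]permM.
by rewrite !cwE // (Aut_closed AutEw).
Qed.

Hypothesis odd_p : odd p.
Hypothesis rankN : forall X : {group gT}, X \subset N -> 'm(X) <= 3.
Variable b : {perm gT}.
Hypotheses (AutNb : b \in Aut N) (moveb : b @: E != E).

Lemma essential_pushing : pushing p N E G b.
Proof.
split=> //; first exact: index_NE.
- by move=> n Nn; exists (conj_aut E n); [apply: conj_autG | move=> x; apply: conj_autN].
- exact: irreducible.
apply: contra nsNE => cEN; apply/subsetP=> n Nn; apply: faithful_mem => // x Ex.
by rewrite (subsetP cEN) ?mem_commg.
Qed.

(** By [Phi_comm_sub], the kernel [K] of [G] on [T / Phi(T)] contains the automorphisms induced by
    [N], so it contains an inversion [w]; coprime action makes the p'-part of [w] fix [T]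
    pointwise. *)
Lemma Phi_inverted : exists2 t, t \in Aut E & {in 'Phi(E), t =1 id}
  /\ {in E, forall x, coset 'Phi(E) (t x) = (coset 'Phi(E) x)^-1}.
Proof.
pose T := 'Phi(E)%G; have sTE : T \subset E := Phi_sub E.
have iPT : invar G 'Phi(T) := char_invar sGE (char_trans (Phi_char T) (Phi_char E)).
have [K defK nsKG] := autker_normal sTE invPhi iPT.
have sNK : conj_aut E @* N \subset K.
  apply/subsetP=> _ /morphimP[n nn Nn ->]; rewrite defK; apply/autkerP.
  split=> [|x Tx]; first exact: conj_autG.
  rewrite conj_autN ?(subsetP sTE) // -commgEl.
  by rewrite (subsetP (Phi_comm_sub essential_pushing)) ?mem_commg.
have [w Kw wE] := normal_inversion nsKG sNK.
have sKE : K \subset Aut E := subset_trans (normal_sub nsKG) sGE.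
have AutEw := subsetP sKE w Kw.
have wj j v : v \in E -> coset T ((w ^+ j) v) = if odd j then (coset T v)^-1 else coset T v.
  move=> Ev; elim: j => [|j IHj]; first by rewrite expg0 perm1.
  rewrite expgSr permM wE ?(Aut_closed (groupX j AutEw)) // IHj /=.
  by case: (odd j); rewrite ?invgK.
(* The exponent is a power of p, hence odd, so [t] still inverts [E / T]; its order is prime to
   p. *)
pose t := w ^+ #[w]`_p; have Kt : t \in K by apply: groupX.
have sBK : <[t]> \subset K by rewrite cycle_subG.
have p't : p^'.-group <[t]>.
  rewrite /pgroup -orderE orderXdiv ?dvdn_part //.
  by rewrite -{1}(partnC p (order_gt0 w)) mulKn ?part_gt0 // part_pnat.
exists t; first exact: subsetP sKE t Kt.
split=> [x Tx|x Ex]; last first.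
  rewrite wj // p_part oddX odd_p orbT //.
have KB a : a \in <[t]> -> a \in K by apply: (subsetP sBK).
apply: (coprime_Phi_fix p_pr (pgroupS sTE pE) _ _ p't) => //; last exact: cycle_id.
  move=> a /KB/(subsetP sKE) AutEa; apply: sub_in2 (AutM AutEa).
  exact: (subsetP sTE).
by move=> a z /KB; rewrite defK => /autkerP[_]; apply.
Qed.

Lemma essential_Phi_der1 : 'Phi(E) = E^`(1) /\ #|E^`(1)| <= p.
Proof.
have [t AutEt [fixt invt]] := Phi_inverted.
have cPhi := inversion_Phi_central odd_p pE AutEt fixt invt.
split; last exact: card_der1_2gen.
exact: (inversion_Phi_der1 odd_p pE AutEt fixt invt).
Qed.

End RankTwo.

(** * Automizers in the fusion system, and the theorem *)

Section FusionSystem.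

Variables (gT : finGroupType) (S E : {group gT}).
Variable F : {set gT} -> (gT -> gT) -> bool.
Hypotheses (fusF : is_fusion_system S F) (sES : E \subset S).

Lemma AutF_group_set : group_set (AutF F E).
Proof.
have [_ Fext Fconj Fcomp _] := fusF; apply/group_setP; split.
  rewrite inE group1; apply: Fext (Fconj E 1 _ sES (group1 S)) _; first exact: groupP.
  by move=> x _; rewrite /conj_map perm1 conjg1.
move=> a c /setIdP[AutEa Fa] /setIdP[AutEc Fc]; rewrite inE groupM //=.
apply: Fext (Fcomp _ _ _ _ Fa Fc _) _ => [|x _]; last by rewrite permM.
by apply/subsetP=> _ /imsetP[x Ex ->]; apply: Aut_closed.
Qed.

Lemma conj_aut_set (X : {set gT}) : X \subset 'N(E) ->
  [set a in Aut E | [exists g in X, [forall x in E, a x == x ^ g]]]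
    = conj_aut E @* X.
Proof.
move=> nEX; apply/setP=> a; rewrite inE.
apply/andP/morphimP=> [[AutEa /exists_inP[g Xg /forall_inP ag]] | [g Ng Xg ->]].
  have Ng := subsetP nEX g Xg; exists g => //; apply: eq_Aut AutEa (Aut_aut _ _) _ => x Ex.
  by rewrite (eqP (ag x Ex)) norm_conj_autE.
split; first exact: Aut_aut.
by apply/exists_inP; exists g => //; apply/forall_inP=> x Ex; rewrite norm_conj_autE.
Qed.

Lemma conj_aut_sub_AutF : conj_aut E @* 'N_S(E) \subset AutF F E.
Proof.
have [_ Fext Fconj _ _] := fusF.
apply/subsetP=> _ /morphimP[g Ng /setIP[Sg _] ->]; rewrite inE Aut_aut /=.
apply: Fext (Fconj E g _ sES Sg) _; first exact: groupP.
by move=> x Ex; rewrite norm_conj_autE.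
Qed.

Lemma inner_normal (G : {group {perm gT}}) :
  G \subset Aut E -> G \subset 'N(conj_aut E @* E).
Proof.
move=> sGE; apply/subsetP=> a Ga; have AutEa := subsetP sGE a Ga; rewrite inE.
apply/subsetP=> _ /imsetP[_ /morphimP[g Ng Eg ->] ->].
have Eag := Aut_closed AutEa Eg.
suff -> : conj_aut E g ^ a = conj_aut E (a g).
  by rewrite mem_morphim // (subsetP (normG E)).
apply: eq_Aut (groupJ _ AutEa) (Aut_aut _ _) _ => [|x Ex]; first exact: Aut_aut.
have Eax : a^-1 x \in E by rewrite (Aut_closed (groupVr AutEa)).
rewrite conjgE !permM !conj_autE //.
by rewrite -(autmE AutEa) morphJ //= autmE permKV.
Qed.

End FusionSystem.

Theorem theoremA (p : nat) (gT : finGroupType) (S : {group gT})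
    (F : {set gT} -> (gT -> gT) -> bool) :
  prime p -> odd p -> p.-group S -> sectional_rank S 3 ->
  saturated S F p ->
  forall E : {group gT},
    essential S F p E -> gen_rank E = 2 ->
    ~ F_characteristic F E S ->
    pearl S F p E.
Proof.
move=> p_pr odd_p pS [rankS _] [fusF satN _] E essE mE nchar; split=> //.
have [sES centE fnE embE] := essE.
pose G := Group (AutF_group_set fusF sES); pose N := ('N_S(E))%G.
pose I := (conj_aut E @* E)%G.
have sEN : E \subset N by rewrite subsetI sES normG.
have nsEN : E <| N by rewrite /normal sEN subsetIr.
have sNS : N \subset S := subsetIl _ _.
have pN := pgroupS sNS pS; have pE := pgroupS sES pS.
have sGE : G \subset Aut E by apply/subsetP=> a /setIdP[].
have sNG : conj_aut E @* N \subset G := conj_aut_sub_AutF fusF sES.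
have sIG : I \subset G by apply: subset_trans sNG; apply: morphimS.
have nsIG : I <| G by rewrite /normal sIG inner_normal.
have [H embH] : exists H : {group coset_of I}, strongly_p_embedded p (G / I) H.
  have InnE : Inn E = I by rewrite /Inn conj_aut_set ?normG.
  by move: embE; rewrite /OutF InnE.
have coreG (R : {group {perm gT}}) : R <| G -> p.-group R -> R \subset I.
  move=> nsRG pR; rewrite -quotient_sub1 ?(subset_trans (normal_sub nsRG)) ?normal_norm //.
  rewrite (strongly_embedded_pcore p_pr embH (quotient_normal _ nsRG)) //.
  exact: quotient_pgroup.
have sylN : p.-Sylow(G) (conj_aut E @* N).
  have [_] := satN E sES fnE.
  by rewrite /AutS conj_aut_set // subsetIr.
have sCE : 'C_N(E) \subset E.
  apply: subset_trans (setSI _ sNS) (centE E _).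
  have [_ Fext Fconj _ _] := fusF.
  exists (conj_map 1); first by apply: Fconj; rewrite ?groupP ?group1.
  apply/setP=> x; apply/idP/imsetP=> [Ex | [y Ey ->]].
    by exists x; rewrite // /conj_map conjg1.
  by rewrite /conj_map conjg1.
(* If [N = E], the inner automorphisms are Sylow in [G], while p divides the order of [G / I]. *)
have nsNE : ~~ (N \subset E).
  apply/negP=> sNE; have [prHG pH _] := embH.
  have p_GI : p %| #|G : I|.
    rewrite -card_quotient ?normal_norm //.
    exact: dvdn_trans pH (cardSg (proper_sub prHG)).
  have [_ _ p'iG] := and3P sylN.
  have := pnat_dvd (dvdn_trans p_GI (indexgS G (morphimS _ sNE))) p'iG.
  by rewrite p'natE // dvdnn.
have rankN (X : {group gT}) : X \subset N -> 'm(X) <= 3.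
  by move=> sXN; apply: rankS; apply: subset_trans sNS.
(* If [N = S], the failure of [E] to be F-characteristic provides [b]. If [N < S], an element of
   [N_S(N)] outside [N = N_S(E)] cannot normalize [E]. *)
have [b AutNb moveb] : exists2 b, b \in Aut N & b @: E != E.
  have [eNS | neNS] := eqVneq (N : {set gT}) S.
    have [/exists_inP[b /setIdP[AutSb _] nb] | nb] :=
        boolP [exists b in AutF F S, b @: E != E].
      by exists b => //; rewrite eNS.
    case: nchar => a Fa; apply/eqP; apply: contraR nb => na.
    by apply/exists_inP; exists a.
  have prNS : N \proper S by rewrite properEneq neNS.
  have [_ /subsetPn[g /setIP[Sg nNg] nNg']] :=
    andP (nilpotent_proper_norm (pgroup_nil pS) prNS).
  exists (conj_aut N g); first exact: Aut_aut.
  apply: contra nNg' => /eqP eE; rewrite inE Sg /=; apply/normP.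
  rewrite -[RHS]eE; apply: eq_in_imset => x Ex.
  by rewrite norm_conj_autE // (subsetP sEN).
have [ePhi leE1] :=
  essential_Phi_der1 p_pr pN nsEN sCE nsNE sGE sNG coreG mE odd_p rankN AutNb moveb.
(* An abelian [E] thus has order p^2 and trivial Frattini subgroup; otherwise [E'] has order exactly
   p and [E] has order p^3. *)
have oE : #|E| = (#|E^`(1)| * p ^ 2)%N.
  by rewrite -(Lagrange (Phi_sub E)) (index_Phi_grank p_pr pE) mE /= ePhi.
have [abE | nabE] := boolP (abelian E).
  have E1 : E^`(1) = 1 by apply/derG1P.
  by rewrite -(trivg_Phi pE) ePhi oE E1 cards1 mul1n !eqxx.
have ntE1 : E^`(1) != 1 by apply: contra nabE => /eqP/derG1P.
have [_ pdvd _] := pgroup_pdiv (pgroupS (der_sub 1 E) pE) ntE1.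
have -> : #|E| = (p ^ 3)%N.
  rewrite oE expnS; congr (_ * _)%N; apply/eqP; rewrite eqn_leq leE1.
  exact: dvdn_leq (cardG_gt0 _) pdvd.
by rewrite eqxx orbT.
Qed.
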